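(* Let $t$ be a fixed positive integer. There exist functions $p_1(x),\dots,p_{t-1}(x),q(x)$ of a real variable $x$, each bounded in absolute value by a polynomial in $x$, with the following property. Let $d=d(n)$ be a non-negative integer-valued function of $n$ with $d=O(\log n)$, and let $\pi\in\mathfrak{S}_n$ be chosen uniformly at random. Then \[ \Pr{\mathrm{mj}(\pi)\geq d+1}=\Big(1+\sum_{i=1}^{t-1}\frac{p_i(d)}{n^{i}}\Big)e^{-2d}+O\!\left(\frac{q(d)e^{2d}}{n^t}\right). \]
   Context: $\mathfrak{S}_n$ is the set of permutations of $[n]=\{1,\dots,n\}$. The minimum jump of $\pi\in\mathfrak{S}_n$ is $\mathrm{mj}(\pi)=\min_{1\le i\le n-1}|\pi(i+1)-\pi(i)|$. *)

(* Defs.v *)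
From mathcomp Require Import all_boot all_order all_fingroup.
From Stdlib Require Import Reals.

Set Implicit Arguments.
Unset Strict Implicit.
Unset Printing Implicit Defensive.

(* Permutations of [n] are modelled as permutations of 'I_n = {0,...,n-1};
   the jumps |pi(i+1) - pi(i)| are unchanged by this shift. *)

Definition natdist (a b : nat) : nat := (a - b) + (b - a).

(* mj(pi) >= k, i.e. every jump |pi(i+1)-pi(i)|, 1 <= i <= n-1, is >= k.
   (For n <= 1 the minimum over the empty set is +infinity, so this holds.) *)
Definition mj_ge (n : nat) (k : nat) (s : 'S_n) : bool :=
  [forall i : 'I_n, forall j : 'I_n,
     (val j == (val i).+1) ==> (k <= natdist (s j) (s i))].

Definition count_mj_ge (n k : nat) : nat := #|[set s : 'S_n | mj_ge k s]|.

Definition prob_mj_ge (n k : nat) : R :=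
  Rdiv (INR (count_mj_ge n k)) (INR (factorial n)).

Definition poly_bounded (f : R -> R) : Prop :=
  exists (c : R) (m : nat), forall x : R, Rle (Rabs (f x)) (Rmult c (pow (Rplus 1 (Rabs x)) m)).

Definition big_O_log (d : nat -> nat) : Prop :=
  exists (K : R) (N : nat), forall n : nat, (N <= n)%coq_nat ->
    Rle (INR (d n)) (Rmult K (ln (INR n))).

Definition corr_sum (t : nat) (p : nat -> R -> R) (x : R) (n : nat) : R :=
  List.fold_right (fun i acc => Rplus (Rdiv (p i x) (pow (INR n) i)) acc) 0%R
    (List.seq 1 (t - 1)).

(* Main.v *)
(** Call a pair [a -> b] with [0 < |b - a| <= d] an arc. By inclusion-exclusion over the
arcs that occur as consecutive values of the permutation,
  [Pr (mj >= d+1) = sum_k (-1)^k (2d)^k/k! * (n^k (n-k)!/n!) * rho_k],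
where [rho_k] is the probability that [k] independent uniform arcs (tail in [[n]],
displacement in [[-d,d]] minus [0]) form a linear forest inside [[n]]; indeed a forest with [k]
arcs is contained in exactly [(n-k)!] linear orders.

The [u]-th difference of [rho] in [k] is the mean of an alternating sum over toggling [u] of
the arcs, which vanishes as soon as one of them is in range and touches no other arc.  It is
therefore [O(poly(k,d) / n^(u/2))], so that modulo [n^-t] the function [rho_k] is the
polynomial in [k] given by Newton's formula.  For fixed [k] the number of [k]-tuples of arcs
forming a forest is a polynomial in [n] of degree at most [k] once [n] is large compared to [d],
since lengthening a gap of [2d] vertices without tails does not affect the forest property.
Hence [n^k (n-k)!/n! * rho_k = 1 + sum_i Q_i(k,d)/n^i] with [Q_i] polynomial in [k].  As
[sum_k (-x)^k/k! 'C(k,b) = (-x)^b/b! * exp (-x)], summing over [k <= sqrt n] yields the main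
term, while the errors are summed with absolute values, whence the factor [exp (2d)]. *)

Require Import Defs.
From Stdlib Require Import Reals Lra Lia ZArith.
From mathcomp Require all_boot all_order all_fingroup all_algebra.
From mathcomp Require zify ring lra boolp Rstruct.

(** The exponent [u/2] comes from pairing: a toggling sum survives only if each of the [u] toggled
    arcs is out of range or meets another arc, and one meeting can serve two of them, so at least
    [u/2] unlikely events must occur. Hence an error [n^-t] takes [2t] differences.

    Small differences make [rho_k] nearly polynomial in [k], but its Newton coefficients still
    depend on [n]; polynomiality in [n] for finitely many fixed [k] turns them into expansions in
    [1/n] whose coefficients depend on [d] alone. The constant term is not computed from these
    formulas: for fixed [k] and [d] it is the limit of [rho_k] as [n] grows, which is 1.

    The expansions are uniform only for [k^2 <= n], where [n^k (n-k)!/n!] stays bounded; for [k]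
    near [n] it grows exponentially. Past the cutoff the terms are at most [(6d)^k/k!], and
    [d = O(log n)] makes their sum, of size [exp (24 d - sqrt n)], smaller than every power of
    [1/n].

    The value [d = 0] is kept apart, since there are then no arcs to sample. *)

Section RealLine.
Local Open Scope R_scope.

Lemma ln_lt_self x : 0 < x -> ln x < x.
Proof.
intros hx; apply exp_lt_inv; rewrite exp_ln by assumption.
assert (h := exp_ineq1 x ltac:(lra)); lra.
Qed.

Lemma ln_le_mono x y : 0 < x -> x <= y -> ln x <= ln y.
Proof.
intros hx [hxy|<-]; [left; apply ln_increasing; assumption|right; reflexivity].
Qed.

(** All largeness conditions on [n] reduce to this one. With [K] the successor of the integer square
    root, [ln n <= 2 ln K = 4 ln (sqrt K) <= 4 sqrt K], and [4 L <= sqrt K] as soon as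
    [K >= 16 L^2]. *)
Lemma log_le_sqrt (L : R) : exists N : nat, forall n : nat, (N <= n)%nat ->
  L * ln (INR n) <= INR (S (Nat.sqrt n)) /\ 1 <= ln (INR n) /\ (S (Nat.sqrt n) <= n)%nat.
Proof.
destruct (INR_unbounded (16 * (L * L))) as [m hm].
(* The summand [m * m] forces [K >= m >= 16 L^2]; the 9 makes [n] exceed [exp 1], whence
   [ln n >= 1]. *)
exists (m * m + 9)%nat; intros n hn.
destruct (Nat.sqrt_spec n (Nat.le_0_l n)) as [h1 h2].
set (r := Nat.sqrt n) in *; set (K := S r).
assert (hK1 : (1 <= K)%nat) by (unfold K; lia).
assert (hnK : (n < K * K)%nat) by exact h2.
assert (hmK : (m <= K)%nat).
{ destruct (Nat.le_gt_cases m K) as [h|h]; [assumption|].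
  assert (K * K <= m * m)%nat by (apply Nat.mul_le_mono; lia); lia. }
assert (hKn : (K <= n)%nat).
{ unfold K; destruct (Nat.le_gt_cases r 1) as [h|h]; [lia|].
  assert (2 * r <= r * r)%nat by (apply Nat.mul_le_mono_r; lia); lia. }
assert (hn9 : (9 <= n)%nat) by lia.
clearbody K; apply le_INR in hmK, hK1, hn9; simpl INR in hK1, hn9.
assert (hKpos : 0 < INR K) by lra.
assert (hnpos : 0 < INR n) by lra.
assert (hln1 : 1 <= ln (INR n)).
{ rewrite <- (ln_exp 1); apply ln_le_mono; [apply exp_pos|].
  assert (h := exp_le_3); lra. }
split; [|split; assumption].
assert (hs : 0 < sqrt (INR K)) by (apply sqrt_lt_R0; assumption).
assert (hss : sqrt (INR K) * sqrt (INR K) = INR K) by (apply sqrt_sqrt; lra).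
assert (hlK : ln (INR K) = 2 * ln (sqrt (INR K))).
{ rewrite <- hss at 1; rewrite ln_mult by assumption; lra. }
assert (hlns := ln_lt_self _ hs).
assert (hlnn : ln (INR n) <= 2 * ln (INR K)).
{ replace (2 * ln (INR K)) with (ln (INR K * INR K)) by (rewrite ln_mult by assumption; lra).
  apply ln_le_mono; [assumption|]; rewrite <- mult_INR; apply le_INR; lia. }
destruct (Rle_dec L 0) as [hL|hL].
- apply Rle_trans with 0; [|lra].
  assert (0 <= (- L) * ln (INR n)) by (apply Rmult_le_pos; lra); lra.
- assert (h4 : 4 * L <= sqrt (INR K)).
  { apply Rnot_lt_le; intros hlt.
    assert (sqrt (INR K) * sqrt (INR K) < (4 * L) * (4 * L)) by (apply Rmult_le_0_lt_compat; lra).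
    lra. }
  apply Rle_trans with (L * (4 * sqrt (INR K))).
  + apply Rmult_le_compat_l; lra.
  + rewrite <- hss at 2.
    replace (L * (4 * sqrt (INR K))) with ((4 * L) * sqrt (INR K)) by ring.
    apply Rmult_le_compat_r; lra.
Qed.

(* [Z.to_nat] vanishes on negative integers, so the extension equals [p 0] left of [1]. *)
Definition extend (p : nat -> R) (x : R) : R := p (Z.to_nat (Int_part x)).

Lemma extend_INR p d : extend p (INR d) = p d.
Proof. unfold extend; rewrite Int_part_INR, Nat2Z.id; reflexivity. Qed.

Lemma extend_poly_bounded p c m :
  (forall d, Rabs (p d) <= c * (1 + INR d) ^ m) -> poly_bounded (extend p).
Proof.
intros h; exists c, m; intros x; unfold extend.
set (d := Z.to_nat (Int_part x)).
assert (hc : 0 <= c).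
{ assert (h0 := h 0%nat); assert (h1 := Rabs_pos (p 0%nat)).
  simpl INR in h0; rewrite Rplus_0_r, pow1 in h0; lra. }
apply Rle_trans with (1 := h d); apply Rmult_le_compat_l; [assumption|].
apply pow_incr; assert (hd := pos_INR d); split; [lra|].
apply Rplus_le_compat_l; unfold d; destruct (Z.le_gt_cases 0 (Int_part x)) as [hx|hx].
- rewrite INR_IZR_INZ, Z2Nat.id by assumption.
  apply Rle_trans with x; [exact (proj1 (base_Int_part x))|apply Rle_abs].
- destruct (Int_part x); simpl; try lia; apply Rabs_pos.
Qed.

End RealLine.

Module Jumps.
Import all_boot all_order all_fingroup all_algebra zify ring lra.
Import Order.TTheory GRing.Theory Num.Theory.
Import boolp Rstruct.
Set Implicit Arguments.
Unset Strict Implicit.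
Unset Printing Implicit Defensive.

(** * Linear orders extending a set of arcs *)

Section Links.
Variable T : eqType.
Implicit Types (s V : seq T) (A : seq (T * T)) (e : T * T).

Definition linked s e := infix [:: e.1; e.2] s.

(** This is the linear forest condition, stated through one duplicate-free word that displays every
    arc as a pair of neighbours. The word may use further letters, so passing to subsets is
    immediate. *)
Definition linkable A := exists2 s, uniq s & all (linked s) A.

Lemma linkedP s a b :
  reflect (exists s1 s2, s = s1 ++ [:: a, b & s2]) (linked s (a, b)).
Proof. by rewrite /linked /=; apply: (iffP (@infixP T [:: a; b] s)) => -[s1 [s2 ->]];
  exists s1, s2. Qed.

Lemma linked_mem s e : linked s e -> (e.1 \in s) && (e.2 \in s).
Proof.
case: e => a b /linkedP[s1 [s2 ->]] /=.
by rewrite !mem_cat !inE !eqxx !orbT.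
Qed.

Lemma linked_filter (P : pred T) s e :
  linked s e -> P e.1 -> P e.2 -> linked (filter P s) e.
Proof.
case: e => a b /linkedP[s1 [s2 ->]] /= Pa Pb.
by apply/linkedP; exists (filter P s1), (filter P s2); rewrite filter_cat /= Pa Pb.
Qed.

Lemma linked_cat s t e : linked s e -> linked (s ++ t) e.
Proof.
case: e => a b /linkedP[s1 [s2 ->]].
by apply/linkedP; exists s1, (s2 ++ t); rewrite -catA.
Qed.

Lemma cat_uniq_inj (a : T) s1 s2 t1 t2 : uniq (s1 ++ a :: s2) ->
  s1 ++ a :: s2 = t1 ++ a :: t2 -> s1 = t1 /\ s2 = t2.
Proof.
elim: s1 t1 => [|x s1 IH] [|y t1] //=.
- by move=> _ [->].
- move=> /andP[na _] [<- E]; move: na; rewrite E mem_cat inE eqxx orbT //.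
- move=> /andP[na _] [xa _]; move: na; rewrite xa mem_cat inE eqxx orbT //.
- by move=> /andP[_ U] [<- E]; have [-> ->] := IH _ U E.
Qed.

Lemma linked_uniq_r s a b c : uniq s -> linked s (a, b) -> linked s (a, c) -> b = c.
Proof.
move=> U /linkedP[s1 [s2 E]] /linkedP[t1 [t2 E']].
move: U; rewrite E => U.
by have [_ [->]] := cat_uniq_inj U (etrans (esym E) E').
Qed.

Lemma linked_uniq_l s a b c : uniq s -> linked s (a, c) -> linked s (b, c) -> a = b.
Proof.
move=> U /linkedP[s1 [s2 E]] /linkedP[t1 [t2 E']].
have E2 : rcons s1 a ++ c :: s2 = rcons t1 b ++ c :: t2 by rewrite !cat_rcons -E -E'.
move: U; rewrite E -cat_rcons => U.
by have [/rcons_inj[]] := cat_uniq_inj U E2.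
Qed.

Lemma linked_neq s a b : uniq s -> linked s (a, b) -> a != b.
Proof.
move=> U /linkedP[s1 [s2 E]]; move: U; rewrite E cat_uniq => /and3P[_ _ /= /andP[]].
by rewrite inE => /norP[].
Qed.

Lemma linkable_sub A A' : {subset A' <= A} -> linkable A -> linkable A'.
Proof. by move=> sA [s Us /allP As]; exists s => //; apply/allP => e /sA/As. Qed.

(* Effect on the other arcs of contracting (a, b): b disappears and its outgoing arc
   now leaves from a. *)
Definition contract (a b : T) e := (if e.1 == b then a else e.1, e.2).

Lemma linked_cons z s x y :
  linked (z :: s) (x, y) = (x == z) && (ohead s == Some y) || linked s (x, y).
Proof.
rewrite /linked infix_consl prefix_cons /=; congr (_ && _ || _).
by case: s => [|u s] //=; rewrite prefix0s andbT eq_sym.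
Qed.

Lemma linked_cat_cons s1 a s2 x y : linked (s1 ++ a :: s2) (x, y) =
  linked (rcons s1 a) (x, y) || linked (a :: s2) (x, y).
Proof.
elim: s1 => [|z s1 IH]; first by rewrite /= [in RHS]linked_cons andbF.
rewrite cat_cons rcons_cons (linked_cons z) IH (linked_cons z) orbA.
by case: s1 {IH}.
Qed.

Lemma uniq_mid s1 s2 a b : uniq (s1 ++ [:: a, b & s2]) ->
  [/\ a \notin s1, a \notin b :: s2, b \notin s1 & b \notin s2].
Proof.
rewrite cat_uniq => /and3P[_ /hasPn h /= /and3P[na nb _]].
by split => //; apply: h; rewrite !inE eqxx ?orbT.
Qed.

Lemma linked_contract s1 s2 a b e (s := s1 ++ [:: a, b & s2]) :
  uniq s -> e.1 != a ->
  linked s e = linked (s1 ++ a :: s2) (contract a b e).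
Proof.
case: e => x y /= U xa; rewrite /contract /=.
have nE t u v : u \notin t -> linked t (u, v) = false.
  by move=> ut; apply/negP => /linked_mem /= /andP[]; rewrite (negbTE ut).
have [as1 as2 bs1 bs2] := uniq_mid U.
rewrite /s !linked_cat_cons 2!linked_cons (negbTE xa) /=.
case: (eqVneq x b) => [xb|xb] /=; last by rewrite linked_cons (negbTE xa).
rewrite xb linked_cons eqxx /= (nE s2 b y) // orbF.
rewrite (nE (rcons s1 a)); last by rewrite mem_rcons inE negb_or bs1 -xb xa.
rewrite (nE s2 a y); last by move: as2; rewrite inE => /norP[].
rewrite orbF /=; case E: (linked _ _) => //; case/linkedP: E => t1 [t2].
have : uniq (rcons s1 a) by rewrite rcons_uniq as1; move: U; rewrite cat_uniq => /andP[].
rewrite -cats1 => U1 E1; have [_] := cat_uniq_inj U1 E1; by [].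
Qed.

Lemma linkable_contract a b A : linkable ((a, b) :: A) -> uniq ((a, b) :: A) ->
  [/\ linkable (map (contract a b) A), uniq (map (contract a b) A),
      {in A, forall e, e.1 != a}, {in A, forall e, e.2 != b} & a != b].
Proof.
move=> [s Us /= /andP[Lab /allP LA]] /andP[abA UA].
have nA : {in A, forall e, e.1 != a}.
  move=> [x y] eA; apply/eqP => /= xa; case/negP: abA.
  by have := LA _ eA; rewrite xa => /(linked_uniq_r Us Lab) ->; rewrite -xa.
have nB : {in A, forall e, e.2 != b}.
  move=> [x y] eA; apply/eqP => /= yb; case/negP: abA.
  by have := LA _ eA; rewrite yb => /(linked_uniq_l Us Lab) ->; rewrite -yb.
split=> //; last exact: linked_neq Us Lab.
  case/linkedP: Lab Us LA => s1 [s2 ->] Us LA.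
  exists (s1 ++ a :: s2).
    apply: subseq_uniq Us; apply: cat_subseq => //=; rewrite eqxx; exact: subseq_cons.
  apply/allP => _ /mapP[e eA ->]; rewrite -linked_contract //; [exact: LA|exact: nA].
rewrite map_inj_in_uniq // => -[x y] [x' y'] eA eA'; rewrite /contract /= => -[].
have /= := nA _ eA; have /= := nA _ eA'.
case: (eqVneq x b) => [->|_]; case: (eqVneq x' b) => [->|_] //.
- by move=> _ _ _ ->.
- by move=> h _ h'; rewrite h' eqxx in h.
- by move=> _ h h'; rewrite h' eqxx in h.
- by move=> _ _ -> ->.
Qed.

(** Deleting [b] is a bijection from the orders of [V] where [b] follows [a] to all orders of [V]
    without [b], and it turns the other arcs into their contractions. Each arc thus costs one
    letter. *)
Lemma count_linked V A : uniq V -> uniq A -> linkable A ->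
  {in A, forall e, (e.1 \in V) && (e.2 \in V)} ->
  count (fun s => all (linked s) A) (permutations V) = (size V - size A)`!.
Proof.
move Em: (size A) => m.
elim: m A Em V => [|m IH] [|[a b] A] //= Em V UV UA LA AV.
  rewrite subn0 -size_permutations // -[RHS]count_predT; exact: eq_count.
have [LA' UA' nA nB ab] := linkable_contract LA UA.
have /andP[/= aV bV] := AV _ (mem_head _ _).
have AV0 e : e \in A -> (e.1 \in V) && (e.2 \in V) by move=> eA; apply: AV; rewrite inE eA orbT.
have E : perm_eq V (b :: rem b V) by apply: perm_to_rem.
have UV' : uniq (rem b V) by apply: rem_uniq.
case: Em => Em; rewrite (perm_size E) /= subSS.
rewrite -(IH (map (contract a b) A) _ _ UV' UA' LA') ?size_map //; last first.
  move=> _ /mapP[e eA ->]; rewrite !(mem_rem_uniq b UV) !inE /contract /=.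
  have /andP[e1 ->] := AV0 _ eA; rewrite nB //= !andbT.
  by case: (eqVneq e.1 b) => [_|->]; rewrite ?ab ?aV ?e1.
have remE s1 s2 : uniq (s1 ++ [:: a, b & s2]) -> rem b (s1 ++ [:: a, b & s2]) = s1 ++ a :: s2.
  move=> U; rewrite rem_filter // filter_cat /= eqxx ab /=.
  have [_ _ bs1 bs2] := uniq_mid U.
  by rewrite !(all_filterP _) //; apply/allP => z zs; apply/eqP => zb;
    move: zs; rewrite zb; apply/negP.
rewrite -!size_filter -(size_map (rem b)); apply: perm_size; apply: uniq_perm.
- rewrite map_inj_in_uniq ?filter_uniq ?permutations_uniq // => s t.
  rewrite !mem_filter !mem_permutations /= => /andP[/andP[Ls _] ps] /andP[/andP[Lt _] pt].
  have Us : uniq s by rewrite (perm_uniq ps).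
  have Ut : uniq t by rewrite (perm_uniq pt).
  case/linkedP: Ls Us {ps} => s1 [s2 ->]; case/linkedP: Lt Ut {pt} => t1 [t2 ->] Ut Us.
  rewrite !remE // => E1; have [|-> -> //] := cat_uniq_inj _ E1.
  by rewrite -remE //; apply: rem_uniq.
- by rewrite filter_uniq ?permutations_uniq.
move=> s; apply/mapP/idP => [[t]|].
  rewrite !mem_filter !mem_permutations /= => /andP[/andP[Lt /allP At] pt] ->.
  have Ut : uniq t by rewrite (perm_uniq pt).
  case/linkedP: Lt Ut pt At => t1 [t2 ->] Ut pt At.
  rewrite remE //; apply/andP; split.
    apply/allP => _ /mapP[e eA ->]; rewrite -linked_contract //; [exact: At | exact: nA].
  rewrite -(perm_cons b) -(permPr E) -(permPr pt) perm_sym -[t1 ++ a :: b :: t2]/(t1 ++ [:: a]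
    ++ [:: b] ++ t2).
  by rewrite (catA t1) (perm_catCA _ [:: b]) /= -catA.
rewrite mem_filter mem_permutations => /andP[/allP As ps].
have Us : uniq s by rewrite (perm_uniq ps).
have bs : b \notin s by rewrite (perm_mem ps) mem_rem_uniqF.
have as_ : a \in s by rewrite (perm_mem ps) mem_rem_uniq // !inE ab.
case/splitPr: as_ ps Us bs As => s1 s2 ps Us bs As.
have Ut : uniq (s1 ++ [:: a, b & s2]).
  by rewrite -[_ :: _]/([:: a] ++ [:: b] ++ s2) catA uniq_catCA /= -catA /= Us andbT.
exists (s1 ++ [:: a, b & s2]); last by rewrite remE.
rewrite mem_filter mem_permutations /=; apply/andP; split; last first.
  rewrite (permPr E) -[_ :: b :: _]/([:: a] ++ [:: b] ++ s2) catA perm_catCA /= perm_cons.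
  by rewrite -catA.
apply/andP; split; first by apply/linkedP; exists s1, s2.
apply/allP => e eA; rewrite linked_contract ?nA //; apply: As.
exact: map_f.
Qed.

End Links.

Local Open Scope ring_scope.

(** * Sums over tuples and finite differences *)

Section TupleSum.
Variables (F : realFieldType) (T : eqType) (X : seq T).
Implicit Types (h : seq T -> F) (s x : seq T) (k : nat).

(** Tuples are ordered and may repeat entries, so dividing by [size X ^ k] gives an expectation over
    [k] independent samples. This independence makes a difference in [k] the insertion of one more
    sample. *)
Fixpoint tsum k h : F :=
  if k is k'.+1 then \sum_(y <- X) tsum k' (fun s => h (y :: s)) else h [::].

Lemma eq_tsum_in k h h' :
  (forall s, size s = k -> {subset s <= X} -> h s = h' s) -> tsum k h = tsum k h'.
Proof.
elim: k h h' => [|k IH] h h' E /=; first exact: E.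
rewrite big_seq [RHS]big_seq; apply: eq_bigr => y yX; apply: IH => s ss sX.
apply: E => /=; first by rewrite ss.
by move=> z; rewrite inE => /orP[/eqP->|/sX].
Qed.

Lemma eq_tsum k h h' : h =1 h' -> tsum k h = tsum k h'.
Proof. by move=> E; apply: eq_tsum_in. Qed.

Lemma tsumD k h h' : tsum k (fun s => h s + h' s) = tsum k h + tsum k h'.
Proof.
elim: k h h' => //= k IH h h'; rewrite -big_split; apply: eq_bigr => y _; exact: IH.
Qed.

Lemma tsumZ k c h : tsum k (fun s => c * h s) = c * tsum k h.
Proof.
elim: k h => //= k IH h; rewrite mulr_sumr; apply: eq_bigr => y _; exact: IH.
Qed.

Lemma tsumB k h h' : tsum k (fun s => h s - h' s) = tsum k h - tsum k h'.
Proof.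
rewrite -[- tsum k h']mulN1r -tsumZ -tsumD; apply: eq_tsum => s.
by rewrite mulN1r.
Qed.

Lemma tsum_sum k (I : Type) (r : seq I) (g : I -> seq T -> F) :
  tsum k (fun s => \sum_(i <- r) g i s) = \sum_(i <- r) tsum k (g i).
Proof.
elim: k g => //= k IH g.
rewrite exchange_big; apply: eq_bigr => y _; exact: IH.
Qed.

Lemma le_tsum k h h' : (forall s, h s <= h' s) -> tsum k h <= tsum k h'.
Proof.
elim: k h h' => //= k IH h h' E; apply: ler_sum => y _; exact: IH.
Qed.

Lemma ler_norm_tsum k h : `|tsum k h| <= tsum k (fun s => `|h s|).
Proof.
elim: k h => //= k IH h; apply: le_trans (ler_norm_sum _ _ _) _.
apply: ler_sum => y _; exact: IH.
Qed.

Lemma tsum_const k c : tsum k (fun=> c) = c * (size X)%:R ^+ k.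
Proof.
elim: k => [|k IH] /=; first by rewrite mulr1.
by rewrite big_const_seq count_predT iter_addr_0 IH exprS mulrCA mulr_natl.
Qed.

Lemma tsum_cat u k h :
  tsum (u + k) h = tsum u (fun p => tsum k (fun s => h (p ++ s))).
Proof. by elim: u h => //= u IH h; apply: eq_bigr => y _; rewrite IH. Qed.

Lemma tsum_rcons k h :
  tsum k.+1 h = \sum_(y <- X) tsum k (fun s => h (rcons s y)).
Proof.
elim: k h => [//|k IH] h.
rewrite -[LHS]/(\sum_(y <- X) tsum k.+1 (fun s => h (y :: s))).
under eq_bigr do rewrite IH.
by rewrite exchange_big.
Qed.

Lemma tsum_rev k h : tsum k (fun s => h (rev s)) = tsum k h.
Proof.
elim: k h => //= k IH h; rewrite -[RHS]/(tsum k.+1 h) tsum_rcons.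
apply: eq_bigr => y _; rewrite -[RHS]IH; apply: eq_tsum => s; by rewrite rev_cons.
Qed.

Lemma tsum_uniq_all k (A : pred T) : uniq X ->
  tsum k (fun x => (uniq x && all A x)%:R) = ((count A X) ^_ k)%:R.
Proof.
move=> UX; elim: k A => [|k IH] A /=; first by rewrite ffactn0.
have E y : y \in X -> tsum k (fun s => ((y \notin s) && uniq s && (A y && all A s))%:R)
   = (A y)%:R * ((count A X).-1 ^_ k)%:R.
  move=> yX; case Ay: (A y); last first.
    rewrite mul0r -[RHS](mul0r ((size X)%:R ^+ k)) -tsum_const.
    by apply: eq_tsum => s; rewrite andbF.
  rewrite mul1r; have -> : (count A X).-1 = count (predI A (predC1 y)) X.
    rewrite -!size_filter [in RHS](_ : filter _ X = rem y (filter A X)).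
      by rewrite size_rem // mem_filter Ay.
    by rewrite rem_filter ?filter_uniq // -filter_predI; apply: eq_filter => z /=; rewrite andbC.
  rewrite -IH; apply: eq_tsum => s; congr (nat_of_bool _)%:R => /=.
  have -> : all (predI A (predC1 y)) s = all A s && (y \notin s).
    by rewrite all_predI -has_pred1 -all_predC.
  by case: (y \in s); case: (uniq s); case: (all A s).
rewrite big_seq (eq_bigr (fun y => (A y)%:R * ((count A X).-1 ^_ k)%:R)) // -big_seq.
rewrite -mulr_suml -natr_sum -natrM; congr (_ %:R).
rewrite -sumn_count sumnE big_map; case: (\sum_(i <- X) _)%N => [|m]; first by rewrite mul0n.
by rewrite ffactnS.
Qed.

End TupleSum.

(** A contributing tuple has at most one entry in [B], and by symmetry that entry can be moved to
    the front from any of its [k.+1] positions. It is meant for [B] the arcs leaving one vertex. *)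
Lemma tsum_block (F : realFieldType) (T : eqType) (B X : seq T) k (h : seq T -> F) :
  (forall s t, perm_eq s t -> h s = h t) ->
  (forall b c s, b \in B -> c \in B -> h [:: b, c & s] = 0) ->
  tsum (B ++ X) k.+1 h
  = tsum X k.+1 h + k.+1%:R * \sum_(b <- B) tsum X k (fun s => h (b :: s)).
Proof.
elim: k h => [|k IH] h hp h0; first by rewrite /= big_cat /= addrC mul1r.
rewrite -[LHS]/(\sum_(y <- B ++ X) tsum (B ++ X) k.+1 (fun s => h (y :: s))).
rewrite big_cat /=.
have hp' y s t : perm_eq s t -> h (y :: s) = h (y :: t) by move=> st; apply: hp;
  rewrite perm_cons.
have -> : \sum_(b <- B) \sum_(y <- B ++ X) tsum (B ++ X) k (fun s => h [:: b, y & s])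
   = \sum_(b <- B) tsum X k.+1 (fun s => h (b :: s)).
  rewrite big_seq [RHS]big_seq; apply: eq_bigr => b bB.
  rewrite -[LHS]/(tsum (B ++ X) k.+1 (fun s => h (b :: s))) IH //; last first.
  - move=> c c' s cB c'B; exact: h0.
  - exact: hp'.
  rewrite big_seq big1 ?mulr0 ?addr0 // => c cB.
  rewrite -[RHS](mul0r ((size X)%:R ^+ k)) -tsum_const; apply: eq_tsum => s; exact: h0.
have -> : \sum_(y <- X) \sum_(y0 <- B ++ X) tsum (B ++ X) k (fun s => h [:: y, y0 & s])
   = \sum_(y <- X) (tsum X k.+1 (fun s => h (y :: s)) +
       k.+1%:R * \sum_(b <- B) tsum X k (fun s => h [:: y, b & s])).
  apply: eq_bigr => y _; rewrite -[LHS]/(tsum (B ++ X) k.+1 (fun s => h (y :: s))) IH //.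
    exact: hp'.
  move=> b c s bB cB; rewrite (hp _ [:: b, c & y :: s]) ?h0 //.
  by rewrite -[y :: _]/([:: y] ++ [:: b; c] ++ s) perm_catCA.
rewrite big_split /= -mulr_sumr exchange_big /=.
rewrite addrA [X in X + _ = _]addrC -addrA; congr (_ + _).
rewrite -[k.+2]addn1 natrD mulrDl mul1r addrC; congr (k.+1%:R * _ + _).
apply: eq_bigr => b _; apply: eq_bigr => y _; apply: eq_tsum => s.
by apply: hp; apply/seq.permP => a /=; rewrite addnCA.
Qed.

Definition fdiff (R : zmodType) (f : nat -> R) (k : nat) : R := f k.+1 - f k.

Section FiniteDifference.
Variable F : realFieldType.
Implicit Types f g : nat -> F.

Lemma eq_fdiff_iter m f g : f =1 g -> iter m (@fdiff F) f =1 iter m (@fdiff F) g.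
Proof. by move=> E; elim: m => //= m IH k; rewrite /fdiff !IH. Qed.

Lemma fdiff_iter_sum m (I : Type) (r : seq I) (g : I -> nat -> F) c k :
  iter m (@fdiff F) (fun k => c * \sum_(i <- r) g i k) k
  = c * \sum_(i <- r) iter m (@fdiff F) (g i) k.
Proof.
elim: m k => //= m IH k; rewrite /fdiff !IH -mulrBr -sumrB //.
Qed.

Lemma fdiff_telescope f k : f k = f 0%N + \sum_(j < k) fdiff f j.
Proof.
elim: k => [|k IH]; first by rewrite big_ord0 addr0.
by rewrite big_ord_recr /= addrA -IH /fdiff addrC subrK.
Qed.

Lemma sum_bin k b : (\sum_(j < k) 'C(j, b) = 'C(k, b.+1))%N.
Proof.
elim: k => [|k IH]; first by rewrite big_ord0 bin0n.
by rewrite big_ord_recr /= IH binS addnC.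
Qed.

(** Induction on the order: the bound for [fdiff f] is summed over [j < k], and [sum_bin] raises the
    lower index of each binomial coefficient by one. *)
Lemma newton_remainder m f k (eps : F) :
  (forall j, (j <= k)%N -> `|iter m (@fdiff F) f j| <= eps) ->
  `|f k - \sum_(b < m) 'C(k, b)%:R * iter b (@fdiff F) f 0%N| <= 'C(k, m)%:R * eps.
Proof.
elim: m f k => [|m IH] f k h; first by rewrite big_ord0 subr0 bin0 mul1r; exact: h.
have hd j : (j < k)%N -> `|fdiff f j - \sum_(b < m) 'C(j, b)%:R * iter b (@fdiff F) (fdiff f) 0%N|
   <= 'C(j, m)%:R * eps.
  move=> jk; apply: IH => i ij; rewrite -iterSr; apply: h; lia.
rewrite big_ord_recl bin0 mul1r /= {1}(fdiff_telescope f k).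
have -> : \sum_(i < m) 'C(k, bump 0 i)%:R * iter (bump 0 i) (@fdiff F) f 0%N =
   \sum_(j < k) \sum_(b < m) 'C(j, b)%:R * iter b (@fdiff F) (fdiff f) 0%N.
  rewrite exchange_big; apply: eq_bigr => b _.
  by rewrite /bump leq0n add1n iterSr -sum_bin natr_sum mulr_suml.
rewrite opprD addrACA subrr add0r -sumrB.
apply: le_trans (ler_norm_sum _ _ _) _.
rewrite -sum_bin natr_sum mulr_suml; apply: ler_sum => j _; exact: hd.
Qed.

Lemma newton_exact m f k : (forall j, iter m (@fdiff F) f j = 0) ->
  f k = \sum_(b < m) 'C(k, b)%:R * iter b (@fdiff F) f 0%N.
Proof.
move=> h; apply/eqP; rewrite -subr_eq0 -normr_le0.
have := @newton_remainder m f k 0; rewrite mulr0; apply => j _; by rewrite h normr0.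
Qed.

Lemma fdiff_iter_bound m f k (c : F) : (forall j, (j <= k + m)%N -> `|f j| <= c) ->
  `|iter m (@fdiff F) f k| <= 2 ^+ m * c.
Proof.
elim: m k => [|m IH] k h /=; first by rewrite mul1r; apply: h; lia.
rewrite /fdiff; apply: le_trans (ler_normB _ _) _.
rewrite exprS -mulrA mulr2n mulrDl mul1r; apply: lerD; apply: IH => j jk; apply: h; lia.
Qed.
End FiniteDifference.

(** * Alternating sums over toggled elements and their decay *)

Section Toggle.
Variables (F : realFieldType) (T : eqType).
Implicit Types (f : seq T -> F) (s p l x : seq T).

(** Unfolded, this is the sum of [(-1)^(|p|-|q|) f (q ++ s)] over the subsequences [q] of [p]. *)
Fixpoint toggle p f s : F :=
  if p is y :: p' then toggle p' (fun s => f (y :: s) - f s) s else f s.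

Lemma toggle_bound p f s c : (forall x, `|f x| <= c) -> `|toggle p f s| <= 2 ^+ size p * c.
Proof.
elim: p f c => [|y p IH] f c h /=; first by rewrite mul1r.
rewrite exprSr -mulrA; apply: IH => x; apply: le_trans (ler_normB _ _) _.
by rewrite mulr2n mulrDl mul1r; apply: lerD.
Qed.

Variables (bad : pred T) (touch : rel T).

(** The list [l] holds the elements already absorbed into [f] by earlier differences. An element
    touching one of them may still influence [f], so only elements away from [l] are required to be
    invisible. *)
Definition insensitive l f := (forall s t, perm_eq s t -> f s = f t) /\
  forall y x, ~~ bad y -> ~~ has (touch y) l -> ~~ has (touch y) x -> f (y :: x) = f x.

Lemma insensitive_diff l f y : insensitive l f ->
  insensitive (y :: l) (fun s => f (y :: s) - f s).
Proof.
move=> [fp fi]; split=> [s t st|z x bz].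
  by rewrite (fp _ _ st) (fp (y :: s) (y :: t)) ?perm_cons.
rewrite /= negb_or => /andP[zy zl] zx; rewrite (fi z x) //; congr (_ - _).
rewrite (fp _ [:: z, y & x]); first by rewrite fi //= negb_or zy.
by apply/seq.permP => a /=; rewrite addnCA.
Qed.

Fixpoint crowded l p s : bool :=
  if p is y :: p' then [|| bad y, has (touch y) l | has (touch y) (p' ++ s)]
                       && crowded (y :: l) p' s else true.

(** In the application [f] is the difference created by toggling [y]. Later toggles evaluate it only
    at sublists of [p ++ s], all of which stay clear of [y]. *)
Lemma toggle_vanish y p f s :
  (forall x, ~~ has (touch y) x -> f x = 0) -> ~~ has (touch y) (p ++ s) ->
  toggle p f s = 0.
Proof.
elim: p f => [|z p IH] f h /=; first exact: h.
rewrite negb_or => /andP[yz yp]; apply: IH => // x yx.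
by rewrite !h ?subrr //= negb_or yz.
Qed.

Lemma toggle_sparse l p f s : insensitive l f -> ~~ crowded l p s -> toggle p f s = 0.
Proof.
elim: p l f => [//|y p IH] l f If /=; rewrite negb_and => /orP[|cr]; last first.
  by apply: IH cr; apply: insensitive_diff.
rewrite !negb_or => /and3P[by_ yl yps]; apply: toggle_vanish yps => x yx.
by rewrite If.2 ?subrr.
Qed.

Fixpoint conflicts x : nat :=
  if x is y :: x' then ((bad y || has (touch y) x') + conflicts x')%N else 0%N.

(** The same count read in the other direction: by [conflicts_rev] it is [conflicts] of the reversed
    tuple, and reversal does not change [tsum]. *)
Fixpoint conflicts_acc l x : nat :=
  if x is y :: x' then ((bad y || has (touch y) l) + conflicts_acc (y :: l) x')%N else 0%N.

Lemma conflicts_rev l x : conflicts (catrev x l) = (conflicts_acc l x + conflicts l)%N.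
Proof. by elim: x l => [|y x IH] l //=; rewrite IH /= addnCA addnA. Qed.

(* [conflicts] compares each element with the ones to its right and [conflicts_acc] with the
   ones to its left, so a crowded element is counted at least once. *)
Lemma crowded_conflicts l p s : crowded l p s ->
  (size p <= conflicts (p ++ s) + conflicts_acc l (p ++ s))%N.
Proof.
elim: p l => [//|y p IH] l /= /andP[h /IH].
by move: h; case: (bad y) => /=; [|case/orP => ->]; rewrite ?orbT; lia.
Qed.

(** The two directional counts add up to at least [size p] on a crowded tuple, so one of them
    reaches half of it. One-sided counts are used because they can be estimated by exposing the
    entries one at a time. *)
Lemma toggle_le_conflicts p f s : insensitive [::] f -> (forall x, `|f x| <= 1) ->
  `|toggle p f s| <= 2 ^+ size p *
    ((uphalf (size p) <= conflicts (p ++ s))%N%:R + (uphalf (size p)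
      <= conflicts (rev (p ++ s)))%N%:R).
Proof.
move=> If fb; have [cr|cr] := boolP (crowded [::] p s); last first.
  rewrite (toggle_sparse If cr) normr0 mulr_ge0 ?exprn_ge0 ?addr_ge0 ?ler0n //.
have := crowded_conflicts cr; rewrite -[conflicts_acc _ _]addn0.
rewrite -[0%N]/(conflicts [::]) -conflicts_rev -/(rev (p ++ s)).
set a := conflicts _; set b := conflicts _ => ab.
apply: le_trans (toggle_bound _ _ fb) _.
rewrite ler_pM2l ?exprn_gt0 ?ltr0n // -natrD ler1n.
have : (uphalf (size p) <= a)%N || (uphalf (size p) <= b)%N.
  rewrite -[_ || _]negbK negb_or -!ltnNge; apply/negP => /andP[]; rewrite uphalfE; lia.
by case/orP => ->; rewrite // addn1.
Qed.

Variables (X : seq T) (delta : F).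
Hypothesis delta_ge0 : 0 <= delta.
Hypothesis bad_count : (count bad X)%:R <= delta * (size X)%:R.
Hypothesis touch_count : forall e, (count (touch^~ e) X)%:R <= delta * (size X)%:R.

Lemma conflict_count x :
  (count (fun y => bad y || has (touch y) x) X)%:R <= (size x).+1%:R * (delta * (size X)%:R).
Proof.
elim: x => [|e x IH] /=; first by rewrite mul1r (eq_count (a2 := bad)) // => y; rewrite orbF.
rewrite -[(size x).+2]addn1 natrD mulrDl mul1r; apply: le_trans (lerD IH (touch_count e)).
rewrite -natrD ler_nat -count_predUI; apply: leq_trans (leq_addr _ _).
by apply: sub_count => y /=; case: (bad y); case: (touch y e); case: (has _ _).
Qed.

(** The head is exposed last: given the other [k] entries it conflicts with probability at most
    [(k+1) delta]. The induction closes because [k^2 + (k+1) <= (k+1)^2]. *)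
Lemma tsum_conflicts k t :
  tsum X k (fun x => (t <= conflicts x)%N%:R) <= (k%:R ^+ 2 * delta) ^+ t * (size X)%:R ^+ k.
Proof.
have D0 n m : 0 <= (n%:R ^+ 2 * delta) ^+ m by rewrite exprn_ge0 // mulr_ge0 ?exprn_ge0 ?ler0n.
elim: k t => [|k IH] [|t].
- by rewrite /= mulr1.
- by rewrite /= mulr1.
- by rewrite expr0 mul1r -[X in _ <= X]mul1r -tsum_const.
have E : tsum X k.+1 (fun x => (t.+1 <= conflicts x)%N%:R) <=
   tsum X k (fun x => (size X)%:R * (t.+1 <= conflicts x)%N%:R
                    + (k.+1%:R * (delta * (size X)%:R)) * (t <= conflicts x)%N%:R).
  rewrite /= -tsum_sum.
  (* [le_tsum] compares summands on all lists, so the length is recorded in the summand, with value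
     0 at other lengths. *)
  rewrite (eq_tsum_in (h' := fun s => if size s == k then \sum_(y <- X)
      ((t < (bad y || has (touch y) s) + conflicts s)%N%:R) else 0)); last first.
    by move=> s -> _; rewrite eqxx.
  apply: le_tsum => s; case: eqP => [sk|_]; last first.
    by rewrite addr_ge0 // mulr_ge0 ?ler0n // mulr_ge0 ?ler0n // mulr_ge0 ?ler0n.
  apply: (@le_trans _ _ (\sum_(y <- X) ((t.+1 <= conflicts s)%N%:R +
      (bad y || has (touch y) s)%:R * (t <= conflicts s)%N%:R))).
    apply: ler_sum => y _; case: (bad y || _); rewrite ?add0n ?add1n ?mul1r ?mul0r ?addr0 //.
    by rewrite ltnS lerDr ler0n.
  rewrite big_split /= big_const_seq count_predT iter_addr_0 -mulr_suml -natr_sum.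
  apply: lerD; first by rewrite mulr_natl.
  apply: ler_wpM2r => //.
  by rewrite -sk; apply: le_trans (conflict_count s); rewrite ler_nat -sumn_count sumnE big_map.
apply: le_trans E _; rewrite tsumD !tsumZ.
have N0 : 0 <= (size X)%:R :> F by rewrite ler0n.
apply: (@le_trans _ _ ((size X)%:R * ((k%:R ^+ 2 * delta) ^+ t.+1 * (size X)%:R ^+ k) +
   k.+1%:R * (delta * (size X)%:R) * ((k%:R ^+ 2 * delta) ^+ t * (size X)%:R ^+ k))).
  by apply: lerD; apply: ler_wpM2l; rewrite ?IH ?mulr_ge0 ?ler0n // mulr_ge0.
rewrite -[leLHS]/(_ + _) (_ : _ + _ = (size X)%:R ^+ k.+1 * ((k%:R ^+ 2 * delta)
  ^+ t * ((k%:R ^+ 2 + k.+1%:R) * delta))); last first.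
  by rewrite !exprS; ring.
rewrite mulrC; apply: ler_wpM2r; first exact: exprn_ge0.
rewrite [leRHS]exprSr; apply: ler_pM; rewrite ?D0 ?mulr_ge0 ?addr_ge0 ?exprn_ge0 ?ler0n //.
  by rewrite lerXn2r ?nnegrE ?mulr_ge0 ?exprn_ge0 ?ler0n // ler_wpM2r //
    lerXn2r ?nnegrE ?ler0n // ler_nat.
by apply: ler_wpM2r => //; rewrite -!natrX -natrD ler_nat; nia.
Qed.

Definition tmean k f : F := tsum X k f / (size X)%:R ^+ k.

(** The means for [k] and [k.+1] samples are coupled by sharing [k] samples: their difference is the
    mean over the extra sample [y] of [f (y :: s) - f s]. Iterating this produces [toggle]. *)
Lemma fdiff_tmean f k u : X != [::] ->
  iter u (@fdiff F) (fun k => tmean k f) k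
  = tsum X u (fun p => tsum X k (toggle p f)) / (size X)%:R ^+ (u + k).
Proof.
move=> X0; have N0 : (size X)%:R != 0 :> F by rewrite pnatr_eq0 size_eq0.
elim: u f => [//|u IH] f; rewrite iterSr /=.
have E : fdiff (fun k => tmean k f) =1
   (fun k => (size X)%:R^-1 * \sum_(y <- X) tmean k (fun s => f (y :: s) - f s)).
  move=> j; rewrite /fdiff /tmean -mulr_suml /=.
  under [X in _ = _ * (X * _)]eq_bigr do rewrite tsumB.
  rewrite sumrB big_const_seq count_predT iter_addr_0 -[tsum X j f *+ _]mulr_natr exprS.
  by field; rewrite expf_neq0.
rewrite (eq_fdiff_iter _ E) fdiff_iter_sum.
rewrite (eq_bigr _ (fun y _ => IH (fun s => f (y :: s) - f s))).
by rewrite -mulr_suml addSn exprS invfM mulrCA.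
Qed.

(** The factor [2 ^+ u] counts the terms of the toggling sum, and the extra 2 the two reading
    directions. *)
Lemma fdiff_tmean_bound f k u : X != [::] -> insensitive [::] f -> (forall x, `|f x| <= 1) ->
  `|iter u (@fdiff F) (fun k => tmean k f) k|
  <= 2 ^+ u.+1 * ((u + k)%:R ^+ 2 * delta) ^+ uphalf u.
Proof.
move=> X0 If fb; rewrite fdiff_tmean //.
have N0 : 0 < (size X)%:R ^+ (u + k) :> F by rewrite exprn_gt0 // ltr0n lt0n size_eq0.
rewrite normrM normfV (ger0_norm (ltW N0)) ler_pdivrMr //.
apply: le_trans (ler_norm_tsum _ _ _) _.
apply: (@le_trans _ _ (tsum X u (fun p => tsum X k (fun s => `|toggle p f s|)))).
  by apply: le_tsum => p; apply: ler_norm_tsum.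
pose g x : F := 2 ^+ u * ((uphalf u <= conflicts x)%N%:R + (uphalf u <= conflicts (rev x))%N%:R).
apply: (@le_trans _ _ (tsum X (u + k) g)).
  rewrite tsum_cat.
  rewrite (eq_tsum_in (h' := fun p => if size p == u then tsum X k (fun s => `|toggle p f s|)
    else 0)); last first.
    by move=> s -> _; rewrite eqxx.
  apply: le_tsum => p; case: eqP => [pu|_].
    by apply: le_tsum => s; rewrite /g -pu; apply: toggle_le_conflicts.
  rewrite -[leLHS](mul0r ((size X)%:R ^+ k)) -tsum_const; apply: le_tsum => s.
  by rewrite /g mulr_ge0 ?exprn_ge0 ?addr_ge0 ?ler0n.
rewrite /g tsumZ tsumD (tsum_rev _ _ (fun x => (uphalf u <= conflicts x)%N%:R)).
have := tsum_conflicts (u + k) (uphalf u); set a := tsum _ _ _; set b := _ * _ ^+ (u + k) => ab.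
rewrite -[leRHS]mulrA -/b exprSr -mulrA ler_pM2l ?exprn_gt0 ?ltr0n //; lra.
Qed.
End Toggle.

(** * Arc sets of bounded displacement *)

Section Valid.
Variable P : pred nat.
Implicit Types (x A : seq (nat * nat)) (e y : nat * nat).

Definition valid x := [&& uniq x, all (fun e => P e.1 && P e.2) x & `[< linkable x >]].

Definition bad y := ~~ [&& P y.1, P y.2 & y.1 != y.2].

Definition touch y e := (y.1 \in [:: e.1; e.2]) || (y.2 \in [:: e.1; e.2]).

Lemma valid_perm x x' : perm_eq x x' -> valid x = valid x'.
Proof.
move=> xx'; rewrite /valid (perm_uniq xx') (perm_all _ xx'); congr [&& _, _ & _].
by apply/asboolP/asboolP; apply: linkable_sub => e; rewrite (perm_mem xx').
Qed.

(** Both ends of [y] are deleted from a word for [x] and appended as a final block. The arcs of [x]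
    avoid these ends, so their neighbours remain neighbours. *)
Lemma linkable_cons y x : y.1 != y.2 -> ~~ has (touch y) x ->
  linkable x -> linkable (y :: x).
Proof.
case: y => a b /= ab /hasPn nx [s Us /allP Ls].
pose Q := [pred z | (z != a) && (z != b)].
exists (filter Q s ++ [:: a; b]).
  rewrite cat_uniq filter_uniq //= !mem_filter /= !eqxx andbF /=.
  by rewrite inE ab.
rewrite /=; apply/andP; split; first by apply/linkedP; exists (filter Q s), [::].
apply/allP => e ex; apply: linked_cat; have := nx e ex.
rewrite /touch /= !inE !negb_or => /andP[/andP[a1 a2] /andP[b1 b2]].
by apply: linked_filter; rewrite ?Ls //= eq_sym ?a1 ?a2 eq_sym ?b1 ?b2.
Qed.

Lemma valid_cons y x : ~~ bad y -> ~~ has (touch y) x -> valid (y :: x) = valid x.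
Proof.
rewrite negbK => /and3P[P1 P2 ny] nx; rewrite /valid /= P1 P2 /=.
have -> /= : y \notin x.
  by apply: contra nx => yx; apply/hasP; exists y; rewrite // /touch inE eqxx.
congr [&& _, _ & _]; apply/asboolP/asboolP; last exact: linkable_cons.
by apply: linkable_sub => e ex; rewrite inE ex orbT.
Qed.

Lemma valid_insensitive (F : realFieldType) :
  insensitive bad touch [::] (fun x => (valid x)%:R : F).
Proof.
by split=> [s t st|y x by_ _ yx]; [rewrite (valid_perm st)|rewrite valid_cons].
Qed.

Lemma sum_linked_valid (F : realFieldType) (V : seq nat) x :
  uniq V -> V =i P ->
  \sum_(s <- permutations V) ((uniq x && all (linked s) x)%:R : F)
  = (size V - size x)`!%:R * (valid x)%:R.
Proof.
move=> UV VP; have [Ux|nUx] /= := boolP (uniq x); last first.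
  by rewrite /valid (negbTE nUx) mulr0 big1.
rewrite -natr_sum (_ : (\sum_(s <- _) _)%N = count (fun s => all (linked s) x)
  (permutations V)); last first.
  by rewrite -sumn_count sumnE big_map.
have [/and3P[_ Px /asboolP Lx]|nv] := boolP (valid x).
  rewrite mulr1 count_linked // => e ex.
  by rewrite !VP; move/allP: Px => /(_ _ ex).
rewrite mulr0; apply/eqP; rewrite pnatr_eq0 -leqn0 leqNgt -has_count.
apply: contra nv => /hasP[s]; rewrite mem_permutations => ps Ls.
rewrite /valid Ux /=; apply/andP; split.
  apply/allP => e ex; have /allP/(_ _ ex)/linked_mem := Ls.
  by rewrite !(perm_mem ps) !VP.
by apply/asboolP; exists s; rewrite // (perm_uniq ps).
Qed.

Lemma sum_bin_alternating (F : realFieldType) m n : (m <= n)%N ->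
  \sum_(k < n.+1) (-1) ^+ k * 'C(m, k)%:R = (m == 0%N)%:R :> F.
Proof.
move=> mn; have -> : (m == 0%N)%:R = (1 - 1 : F) ^+ m by rewrite subrr expr0n.
rewrite addrC exprD1n (big_ord_widen n.+1 (fun i => (-1) ^+ i *+ 'C(m, i))) //.
rewrite [RHS]big_mkcond; apply: eq_bigr => k _; rewrite mulr_natr.
by case: ltnP => // mk; rewrite bin_small.
Qed.

(** Arcs displayed by a duplicate-free word have distinct tails. This guarantees that the
    alternating binomial sum cut at the word length is complete. *)
Lemma count_linked_le (X : seq (nat * nat)) s : uniq X -> uniq s ->
  (count (linked s) X <= size s)%N.
Proof.
move=> UX Us; rewrite -size_filter -(size_map fst); apply: uniq_leq_size.
  rewrite map_inj_in_uniq ?filter_uniq // => -[a b] [a' b'].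
  rewrite !mem_filter /= => /andP[L _] /andP[L' _] aa; move: L'; rewrite -aa => L'.
  by rewrite (linked_uniq_r Us L L').
by move=> a /mapP[e]; rewrite mem_filter => /andP[/linked_mem/andP[? _] _] ->.
Qed.

(** Inclusion-exclusion is applied to each word separately, where it is [sum_k (-1)^k 'C(m,k)] with
    [m] the number of arcs displayed; [k]-subsets are counted as injective tuples divided by [k!],
    and then the sums over words and tuples are exchanged. *)
Lemma count_avoiding (F : realFieldType) (V : seq nat) (X : seq (nat * nat)) :
  uniq V -> V =i P -> uniq X ->
  (count (fun s => ~~ has (linked s) X) (permutations V))%:R
  = \sum_(k < (size V).+1) (-1) ^+ k * (size V - k)`!%:R / k`!%:R
      * tsum X k (fun x => (valid x)%:R) :> F.
Proof.
move=> UV VP UX.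
have -> : (count (fun s => ~~ has (linked s) X) (permutations V))%:R
   = \sum_(s <- permutations V) ((count (linked s) X == 0%N)%:R : F).
  rewrite -sumn_count sumnE big_map natr_sum; apply: eq_bigr => s _.
  by rewrite has_count -eqn0Ngt.
have E s : s \in permutations V -> (count (linked s) X == 0%N)%:R =
  \sum_(k < (size V).+1) ((-1) ^+ k / k`!%:R
     * tsum X k (fun x => (uniq x && all (linked s) x)%:R)) :> F.
  rewrite mem_permutations => ps.
  rewrite -(@sum_bin_alternating _ _ (size V)); last first.
    by rewrite -(perm_size ps) count_linked_le // (perm_uniq ps).
  apply: eq_bigr => k _; rewrite tsum_uniq_all // -bin_ffact natrM -mulrA; congr (_ * _).
  by rewrite mulrCA mulVf ?mulr1 // pnatr_eq0 -lt0n fact_gt0.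
rewrite big_seq (eq_bigr _ E) -big_seq exchange_big /=; apply: eq_bigr => k _.
rewrite -mulr_sumr -tsum_sum.
rewrite (eq_tsum_in (h' := fun x => (size V - k)`!%:R * (valid x)%:R)); last first.
  by move=> x <- _; rewrite sum_linked_valid.
by rewrite tsumZ; ring.
Qed.
End Valid.

(** For the direct implication, letters outside the image of [f] are first removed from the word,
    which keeps the required neighbours together. It is needed for relabellings that skip a
    vertex. *)
Lemma linkable_map (T T' : eqType) (f : T -> T') (g : T' -> T) (A : seq (T * T)) :
  cancel f g -> linkable (map (fun e => (f e.1, f e.2)) A) <-> linkable A.
Proof.
move=> fK; split=> -[s Us /allP Ls].
  pose Q := [pred z | f (g z) == z].
  exists (map g (filter Q s)).
    rewrite map_inj_in_uniq ?filter_uniq // => z z'; rewrite !mem_filter /=.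
    by move=> /andP[/eqP <- _] /andP[/eqP <- _]; rewrite !fK => ->.
  apply/allP => -[a b] eA; have L := Ls _ (map_f _ eA).
  have := linked_filter (P := Q) L; rewrite /= !fK !eqxx => /(_ isT isT)/linkedP[s1 [s2 ->]].
  by apply/linkedP; exists (map g s1), (map g s2); rewrite map_cat /= !fK.
exists (map f s); first by rewrite map_inj_uniq //; apply: can_inj fK.
apply/allP => _ /mapP[[a b] eA ->]; have /linkedP[s1 [s2 ->]] := Ls _ eA.
by apply/linkedP; exists (map f s1), (map f s2); rewrite map_cat.
Qed.

Lemma tsum_map (F : realFieldType) (T T' : eqType) (g : T -> T') X k (h : seq T' -> F) :
  tsum (map g X) k h = tsum X k (fun x => h (map g x)).
Proof.
by elim: k h => //= k IH h; rewrite big_map; apply: eq_bigr => y _; rewrite IH.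
Qed.

(* Vertices are shifted by d, so that the head a + c - d of an arc leaving a
   remains a natural number even when it falls outside of {0, ..., n-1}. *)
Definition arcs_at d a : seq (nat * nat) :=
  [seq (a + d, a + c)%N | c <- rem d (iota 0 (d.*2.+1))].

Definition arcs d p n : seq (nat * nat) := flatten [seq arcs_at d a | a <- iota p n].

Definition inside d n : pred nat := fun v => (d <= v < n + d)%N.

Lemma mem_arcs_at d a e :
  (e \in arcs_at d a) = [&& e.1 == a + d, a <= e.2, e.2 <= a + d.*2 & e.2 != e.1]%N.
Proof.
case: e => u v /=; apply/mapP/and4P => [[c]|[/eqP -> av va vu]].
  rewrite (mem_rem_uniq d (iota_uniq _ _)) !inE mem_iota => /andP[cd c2] [-> ->].
  by split; apply/eqP || idtac; lia.
exists (v - a)%N; last by congr (_, _); lia.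
rewrite (mem_rem_uniq d (iota_uniq _ _)) !inE mem_iota; lia.
Qed.

Lemma size_arcs_at d a : size (arcs_at d a) = d.*2.
Proof. by rewrite size_map size_rem ?size_iota // mem_iota; lia. Qed.

Lemma arcs_at_uniq d a : uniq (arcs_at d a).
Proof.
rewrite map_inj_uniq ?rem_uniq ?iota_uniq // => c c' [] /eqP.
by rewrite eqn_add2l => /eqP.
Qed.

Lemma mem_arcs d p n e : (e \in arcs d p n) =
  [&& p + d <= e.1, e.1 < p + n + d, e.1 <= e.2 + d, e.2 <= e.1 + d & e.2 != e.1]%N.
Proof.
apply/flatten_mapP/and5P => [[a]|[h1 h2 h3 h4 h5]].
  by rewrite mem_iota mem_arcs_at => ha /and4P[/eqP h1 h2 h3 h4]; split=> //; lia.
exists (e.1 - d)%N; first by rewrite mem_iota; lia.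
by rewrite mem_arcs_at h5 andbT; apply/and3P; split; apply/eqP || idtac; lia.
Qed.

Lemma arcsS d p n : arcs d p n.+1 = arcs_at d p ++ arcs d p.+1 n.
Proof. by []. Qed.

Lemma size_arcs d p n : size (arcs d p n) = (d.*2 * n)%N.
Proof.
elim: n p => [|n IH] p; first by rewrite muln0.
by rewrite arcsS size_cat size_arcs_at IH mulnS.
Qed.

Lemma arcs_uniq d p n : uniq (arcs d p n).
Proof.
elim: n p => [//|n IH] p; rewrite arcsS cat_uniq arcs_at_uniq IH andbT /=.
apply/hasPn => e; rewrite mem_arcs mem_arcs_at => /and5P[h _ _ _ _].
by apply/negP => /and4P[/eqP h1 _ _ _]; lia.
Qed.

Lemma count_arcs_tail d n v : (count (fun y => y.1 == v) (arcs d 0 n) <= d.*2)%N.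
Proof.
rewrite -size_filter -(size_arcs_at d (v - d)); apply: uniq_leq_size.
  by rewrite filter_uniq ?arcs_uniq.
move=> [a b]; rewrite mem_filter mem_arcs mem_arcs_at /= => /andP[/eqP -> /and5P[h1 h2 h3 h4 h5]].
rewrite h5 andbT; apply/and3P; split; first apply/eqP; move: h1 h2 h3 h4; clear; lia.
Qed.

Lemma count_arcs_head d n v : (count (fun y => y.2 == v) (arcs d 0 n) <= d.*2)%N.
Proof.
pose L := [seq (w, v) | w <- rem v (iota (v - d) d.*2.+1)].
have -> : d.*2 = size L.
  by rewrite size_map size_rem ?size_iota // mem_iota; lia.
rewrite -size_filter; apply: uniq_leq_size.
  by rewrite filter_uniq ?arcs_uniq.
move=> [a b]; rewrite mem_filter mem_arcs /= => /andP[/eqP -> /and5P[h1 h2 h3 h4 h5]].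
apply/mapP; exists a => //; rewrite mem_rem_uniq ?iota_uniq // !inE eq_sym h5 mem_iota /=; lia.
Qed.

Lemma count_arcs_head_in d n (L : seq nat) :
  (count (fun y => y.2 \in L) (arcs d 0 n) <= size L * d.*2)%N.
Proof.
elim: L => [|v L IH]; first by rewrite (eq_count (a2 := pred0)) ?count_pred0.
rewrite mulSn; apply: leq_trans (leq_add (count_arcs_head d n v) IH).
rewrite -count_predUI; apply: leq_trans (leq_addr _ _).
by apply: sub_count => y /=; rewrite inE.
Qed.

(** The head of such an arc is one of the [2d] vertices just outside the range, [d] on each side,
    and each vertex is the head of at most [2d] arcs. *)
Lemma count_bad_arcs d n : (count (bad (inside d n)) (arcs d 0 n) <= d.*2 * d.*2)%N.
Proof.
pose L := iota 0 d ++ iota (n + d) d.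
have {1}-> : d.*2 = size L by rewrite size_cat !size_iota addnn.
apply: leq_trans (count_arcs_head_in d n L).
rewrite -!size_filter; apply: uniq_leq_size; first by rewrite filter_uniq ?arcs_uniq.
move=> e; rewrite !mem_filter /L mem_cat !mem_iota /bad /inside mem_arcs /=.
by case/andP => h /and5P[h1 h2 h3 h4 h5]; rewrite h1 h2 h3 h4 h5 !andbT; lia.
Qed.

Lemma count_touch_arcs d n e : (count (touch^~ e) (arcs d 0 n) <= d.*2 * 4)%N.
Proof.
have le a b : (count (fun y : nat * nat => a y || b y) (arcs d 0 n) <=
    count a (arcs d 0 n) + count b (arcs d 0 n))%N.
  by rewrite -count_predUI leq_addr.
have -> : (d.*2 * 4 = d.*2 + d.*2 + (d.*2 + d.*2))%N by lia.
rewrite (eq_count (a2 := fun y => ((y.1 == e.1) || (y.1 == e.2)) || ((y.2 == e.1)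
  || (y.2 == e.2)))); last first.
  by move=> y; rewrite /touch !inE.
apply: leq_trans (le _ _) _.
by apply: leq_add; apply: leq_trans (le _ _) _; apply: leq_add;
  rewrite ?count_arcs_tail ?count_arcs_head.
Qed.

Lemma arcs_shift d p n : arcs d p.+1 n = [seq (e.1.+1, e.2.+1) | e <- arcs d p n].
Proof.
elim: n p => [//|n IH] p; rewrite !arcsS map_cat IH; congr (_ ++ _).
by rewrite /arcs_at -map_comp; apply: eq_map => c.
Qed.

(** * Polynomial dependence on n of the number of valid tuples *)

Section Polynomiality.
Variables (F : realFieldType) (d : nat).

(** State of a left-to-right scan of the tails: [pre] holds the arcs already chosen, [v] arcs are
    still to be chosen, and their tails come from the [n] positions starting at [p]. *)
Definition extensions pre v p n : F :=
  tsum (arcs d p n) v (fun x => (valid (inside d (p + n)) (pre ++ x))%:R).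

Lemma extensions_step pre v p n : extensions pre v.+1 p n.+1 = extensions pre v.+1 p.+1 n
  + v.+1%:R * \sum_(e <- arcs_at d p) extensions (e :: pre) v p.+1 n.
Proof.
rewrite /extensions arcsS tsum_block; last first.
- move=> b c s bB cB; rewrite /valid.
  case: asboolP => [[s' Us /allP Ls]|]; last by rewrite !andbF.
  suff -> : b = c by rewrite !cat_uniq /= inE eqxx /= !andbF.
  have Lb : linked s' b by apply: Ls; rewrite mem_cat !inE eqxx orbT.
  have Lc : linked s' c by apply: Ls; rewrite mem_cat !inE eqxx !orbT.
  move: bB cB Lb Lc; rewrite !mem_arcs_at; case: b c {Ls} => [b1 b2] [c1 c2] /=.
  by move=> /andP[/eqP -> _] /andP[/eqP -> _] /(linked_uniq_r Us) h /h ->.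
- by move=> s t st; rewrite (@valid_perm _ _ (pre ++ t)) // perm_cat2l.
rewrite addSnnS; congr (_ + _ * _); apply: eq_bigr => e _; apply: eq_tsum => s.
congr (nat_of_bool _)%:R; apply: valid_perm.
by rewrite -cat1s perm_catCA.
Qed.

Lemma extensions0 pre p n : extensions pre 0 p n.+1 = extensions pre 0 p.+1 n.
Proof. by rewrite /extensions /= addSnnS. Qed.

Definition far (pre : seq (nat * nat)) p :=
  (d.*2 <= p)%N /\ {in pre, forall e, (e.1 < p) && (e.2 < p)}%N.

(* An empty stretch of length 2 d isolates the arcs of pre from the later ones,
   and lengthening it by one changes nothing. *)
Lemma extensions_far pre v p n : far pre p -> extensions pre v p.+1 n = extensions pre v p n.
Proof.
move=> [dp prep]; rewrite /extensions arcs_shift tsum_map; apply: eq_tsum_in => x _ xX.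
congr (nat_of_bool _)%:R.
(* The relabelling opens a new vertex at [p]. It fixes [pre], which lies below [p], and shifts the
   remaining arcs, whose tails are at least [p + d] and whose heads are therefore at least [p]. *)
pose f u := if (u < p)%N then u else u.+1.
pose g u := if (u < p)%N then u else u.-1.
have fK : cancel f g by move=> u; rewrite /f /g; case: (ltnP u p) => h; [rewrite h|case: ltnP;
  lia].
pose ff (e : nat * nat) := (f e.1, f e.2).
have -> : pre ++ [seq (e.1.+1, e.2.+1) | e <- x] = map ff (pre ++ x).
  rewrite map_cat; congr (_ ++ _).
    rewrite -[LHS]map_id; apply/eq_in_map => -[a b] /prep /= /andP[ap bp].
    by rewrite /ff /f /= ap bp.
  apply/eq_in_map => -[a b] /xX; rewrite mem_arcs /= => /and5P[h1 h2 h3 h4 h5].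
  have pa : (p <= a)%N by move: h1; clear; lia.
  have pb : (p <= b)%N by move: h1 h3; clear; lia.
  by rewrite /ff /f /= !ltnNge pa pb.
have ffinj : injective ff by move=> [a b] [a' b'] [] /(can_inj fK) -> /(can_inj fK) ->.
rewrite /valid map_inj_uniq // all_map; congr [&& _, _ & _].
  apply: eq_all => -[a b] /=; rewrite /inside /f.
  by move: dp; clear; case: (ltnP a p) => ha; case: (ltnP b p) => hb; lia.
apply/asboolP/asboolP => h; first exact/(linkable_map _ fK).
exact/(linkable_map _ fK).
Qed.

(** With the shifted vertices an arc at position [p] reaches at most [p + 2d], so the scan is clear
    of it [2d] positions after [p.+1]. *)
Lemma far_cons pre p m e : far pre (p + m) -> e \in arcs_at d p ->
  (m <= d.*2)%N -> far (e :: pre) (p.+1 + d.*2).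
Proof.
move=> [dp h] eB md; split; first lia.
move=> e'; rewrite inE => /orP[/eqP->|/h /andP[a b]]; last by apply/andP; split; lia.
case: e eB => u w; rewrite mem_arcs_at /= => /and4P[/eqP -> _ h3 _].
by apply/andP; split; [|move: h3]; clear; lia.
Qed.

Lemma fdiff_iter_add m (f g : nat -> F) k :
  iter m (@fdiff F) (fun k => f k + g k) k = iter m (@fdiff F) f k + iter m (@fdiff F) g k.
Proof. by elim: m k => //= m IH k; rewrite /fdiff !IH; ring. Qed.

Lemma fdiff_iter_shift m (f : nat -> F) k :
  iter m (@fdiff F) (fun k => f k.+1) k = iter m (@fdiff F) f k.+1.
Proof. by elim: m k => //= m IH k; rewrite /fdiff !IH. Qed.

(** Here [m] is the number of positions to scan until [pre] is out of reach. At [m = 0] translation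
    invariance turns the recurrence into a formula for the difference in [n], with one arc fewer;
    otherwise one position is scanned and [m] drops. Each chosen arc uses one position and resets
    [m] to [2d], whence the threshold. *)
Lemma extensions_polynomial v m pre p n : (m <= d.*2)%N -> far pre (p + m) ->
  (d.*2.+1 * v + m <= n)%N -> iter v.+1 (@fdiff F) (extensions pre v p) n = 0.
Proof.
elim: v m pre p n => [|v IHv].
  elim=> [|m IHm] pre p n md fp hn /=.
    by rewrite addn0 in fp; rewrite /fdiff extensions0 extensions_far ?subrr.
  case: n hn => [|n] hn; first lia.
  have := IHm pre p.+1 n; rewrite /= /fdiff !extensions0 addSnnS; apply => //; lia.
(* The step from [m] to [m.+1] takes one difference more than [IHv] controls, so its vanishing is
   first passed on to all higher orders. *)
have IHe j pre p m n e : (m <= d.*2)%N -> far pre (p + m) -> e \in arcs_at d p ->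
  (d.*2.+1 * v.+1 <= n.+1)%N ->
  iter (v.+1 + j) (@fdiff F) (extensions (e :: pre) v p.+1) n = 0.
  move=> md fp eB hn; elim: j n hn => [|j IHj] n hn.
    rewrite addn0; apply: (IHv d.*2) => //; last lia.
    exact: far_cons fp eB md.
  rewrite addnS iterS -[LHS]/(iter (v.+1 + j) (@fdiff F) _ n.+1 - iter (v.+1 + j) (@fdiff F) _ n).
  by rewrite !IHj ?subrr //; lia.
elim=> [|m IHm] pre p n md fp hn.
  rewrite iterSr (@eq_fdiff_iter _ _ _ (fun n => v.+1%:R *
      \sum_(e <- arcs_at d p) extensions (e :: pre) v p.+1 n)); last first.
    move=> k; rewrite /fdiff extensions_step extensions_far; first by rewrite addrC addKr.
    by rewrite addn0 in fp.
  rewrite fdiff_iter_sum big_seq big1 ?mulr0 // => e eB.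
  by have := IHe 0%N pre p 0%N n e md fp eB; rewrite [(v.+1 + 0)%N]addn0; apply; lia.
case: n hn => [|n] hn; first lia.
rewrite -fdiff_iter_shift (@eq_fdiff_iter _ _ _ (fun n => extensions pre v.+1 p.+1 n +
   v.+1%:R * \sum_(e <- arcs_at d p) extensions (e :: pre) v p.+1 n)); last first.
  by move=> k; rewrite extensions_step.
rewrite fdiff_iter_add fdiff_iter_sum (IHm pre) ?addSnnS //; try lia.
rewrite add0r big_seq big1 ?mulr0 // => e eB.
have := IHe 1%N pre p m.+1 n e md fp eB; rewrite [(v.+1 + 1)%N]addn1; apply; lia.
Qed.

Definition valid_count v n : F :=
  tsum (arcs d 0 n) v (fun x => (valid (inside d n) x)%:R).

Lemma valid_count_polynomial v n : (d.*2.+1 * v.+1 <= n)%N ->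
  iter v.+1 (@fdiff F) (valid_count v) n = 0.
Proof.
move=> hn; apply: (@extensions_polynomial v d.*2 [::] 0 n) => //; last lia.
Qed.
End Polynomiality.

(** * Permutations as words on the shifted vertex set *)

Section Words.
Local Open Scope nat_scope.
Variables d n : nat.

Definition word (s : 'S_n) : seq nat := [seq s i + d | i <- enum 'I_n].

Lemma nth_word (s : 'S_n) (i : 'I_n) : nth 0 (word s) i = s i + d.
Proof.
rewrite (nth_map i) ?size_enum_ord ?ltn_ord //.
by rewrite (nth_ord_enum i i).
Qed.

Lemma word_inj : injective word.
Proof.
move=> s t st; apply/perm.permP => i; apply/val_inj/eqP.
by rewrite /= -(eqn_add2r d) -!nth_word st.
Qed.

Lemma perm_word : perm_eq [seq word s | s <- enum 'S_n] (permutations (iota d n)).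
Proof.
have sub : {subset [seq word s | s <- enum 'S_n] <= permutations (iota d n)}.
  move=> _ /mapP[s _ ->]; rewrite mem_permutations; apply: uniq_perm.
  - rewrite map_inj_uniq ?enum_uniq // => i j /eqP; rewrite eqn_add2r => /eqP ij.
    exact/(perm_inj (s := s))/val_inj.
  - exact: iota_uniq.
  move=> v; rewrite mem_iota; apply/mapP/andP => [[i _ ->]|[dv vn]].
    by have := ltn_ord (s i); split; lia.
  have vn' : v - d < n by lia.
  exists ((s^-1)%g (Ordinal vn')); first by rewrite mem_enum.
  by rewrite permKV /=; lia.
have U : uniq [seq word s | s <- enum 'S_n].
  by rewrite map_inj_uniq ?enum_uniq //; apply: word_inj.
apply: uniq_perm => //; first exact: permutations_uniq.
apply: (uniq_min_size U sub _).2.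
rewrite size_map size_permutations ?iota_uniq // size_iota -cardE.
by rewrite -card_Sn.
Qed.

Lemma mj_ge_word (s : 'S_n) : mj_ge d.+1 s = ~~ has (linked (word s)) (arcs d 0 n).
Proof.
apply/forallP/hasPn => [h [u v] uv|h i].
  apply/negP => /linkedP[s1 [s2 E]].
  have sz : size (word s) = n by rewrite size_map size_enum_ord.
  have szE : size (word s) = (size s1 + (size s2).+2)%N by rewrite E size_cat.
  have i1 : size s1 < n by lia.
  have i2 : (size s1).+1 < n by lia.
  have := nth_word s (Ordinal i1); rewrite E /= nth_cat ltnn subnn /= => Eu.
  have := nth_word s (Ordinal i2); rewrite E /= nth_cat ltnNge leqnSn /= subSn // subnn /= => Ev.
  have /forallP/(_ (Ordinal i2)) := h (Ordinal i1); rewrite /= eqxx /=.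
  by move: uv; rewrite mem_arcs Eu Ev /natdist /= => /and5P[_ _ a b _]; lia.
apply/forallP => j; apply/implyP => /eqP ij.
rewrite leqNgt; apply/negP => dj.
have L : linked (word s) (s i + d, s j + d).
  apply/linkedP; exists (take i (word s)), (drop j.+1 (word s)).
  have sz : size (word s) = n by rewrite size_map size_enum_ord.
  rewrite -(nth_word s i) -(nth_word s j) -drop_nth ?sz ?ltn_ord //.
  rewrite ij -drop_nth ?sz ?ltn_ord //.
  by rewrite cat_take_drop.
have ij' : s i != s j :> nat.
  by apply/eqP => /val_inj/perm_inj ii; move: ij; rewrite ii; lia.
have : (s i + d, s j + d) \in arcs d 0 n.
  rewrite mem_arcs /=; move: dj ij' (ltn_ord (s i)); rewrite /natdist.
  clear; move: (nat_of_ord (s i)) (nat_of_ord (s j)) => a b; lia.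
by move=> /h; rewrite L.
Qed.

Lemma count_mj_geE : count_mj_ge n d.+1 =
  count (fun s => ~~ has (linked s) (arcs d 0 n)) (permutations (iota d n)).
Proof.
rewrite -(seq.permP perm_word) count_map /count_mj_ge cardsE cardE /enum_mem size_filter.
by rewrite count_filter; apply: eq_count => s; rewrite /= andbT -mj_ge_word.
Qed.
End Words.

(** * Expansions in powers of 1/n *)

Section Classes.
Variable F : realFieldType.

Definition pbound (c : nat -> F) :=
  exists C m, forall d, `|c d| <= C * d.+1%:R ^+ m.

Lemma expr_succ_le (k m m' : nat) : (m <= m')%N -> k.+1%:R ^+ m <= k.+1%:R ^+ m' :> F.
Proof. by move=> mm; rewrite ler_weXn2l // ler1n. Qed.

Lemma eq_pbound c c' : c =1 c' -> pbound c -> pbound c'.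
Proof. by move=> E [C [m h]]; exists C, m => d; rewrite -E. Qed.

Lemma pboundD c c' : pbound c -> pbound c' -> pbound (fun d => c d + c' d).
Proof.
move=> [C [m h]] [C' [m' h']].
have C0 : 0 <= C by have := le_trans (normr_ge0 _) (h 0%N); rewrite expr1n mulr1.
have C'0 : 0 <= C' by have := le_trans (normr_ge0 _) (h' 0%N); rewrite expr1n mulr1.
exists (C + C'), (m + m')%N => d; apply: le_trans (ler_normD _ _) _.
rewrite mulrDl; apply: lerD.
  by apply: le_trans (h d) _; rewrite ler_wpM2l // expr_succ_le ?leq_addr.
by apply: le_trans (h' d) _; rewrite ler_wpM2l // expr_succ_le ?leq_addl.
Qed.

Lemma pboundM c c' : pbound c -> pbound c' -> pbound (fun d => c d * c' d).
Proof.
move=> [C [m h]] [C' [m' h']]; exists (C * C'), (m + m')%N => d.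
by rewrite normrM exprD mulrACA ler_pM.
Qed.

Lemma pbound_const a : pbound (fun=> a).
Proof. by exists `|a|, 0%N => d; rewrite mulr1. Qed.

Lemma pbound_succ : pbound (fun d => d.+1%:R).
Proof. by exists 1, 1%N => d; rewrite mul1r normr_nat. Qed.

Lemma pbound_nat : pbound (fun d => d%:R).
Proof. by exists 1, 1%N => d; rewrite mul1r normr_nat ler_nat. Qed.

Lemma pboundX c m : pbound c -> pbound (fun d => c d ^+ m).
Proof.
move=> h; elim: m => [|m IH]; first exact: pbound_const.
by apply: eq_pbound (pboundM h IH) => d; rewrite exprS.
Qed.

Lemma pbound_le c c' : (forall d, `|c d| <= `|c' d|) -> pbound c' -> pbound c.
Proof. by move=> cc [C [m h]]; exists C, m => d; apply: le_trans (cc d) (h d). Qed.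

Lemma pbound_sum n (c : nat -> nat -> F) :
  (forall b, (b < n)%N -> pbound (c b)) -> pbound (fun d => \sum_(b < n) c b d).
Proof.
elim: n => [|n IH] h.
  by apply: eq_pbound (pbound_const 0) => d; rewrite big_ord0.
apply: (eq_pbound (c := fun d => \sum_(b < n) c b d + c n d)).
  by move=> d; rewrite big_ord_recr.
by apply: pboundD; [apply: IH => b bn; apply: h; apply: ltnW|apply: h].
Qed.

(* Functions of (k, d) that are polynomial in k, with coefficients of polynomial growth in d. *)
Inductive Pol : (nat -> nat -> F) -> Prop :=
| Pol_zero f : (forall k d, f k d = 0) -> Pol f
| Pol_step f : pbound (f 0%N) -> Pol (fun k d => f k.+1 d - f k d) -> Pol f.

Lemma eq_Pol f g : (forall k d, f k d = g k d) -> Pol f -> Pol g.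
Proof.
move=> + Pf; elim: Pf g => {f} [f f0|f f0 _ IH] g E.
  by apply: Pol_zero => k d; rewrite -E.
apply: Pol_step; first exact: eq_pbound (E 0%N) f0.
by apply: IH => k d; rewrite !E.
Qed.

Lemma PolD f g : Pol f -> Pol g -> Pol (fun k d => f k d + g k d).
Proof.
move=> Pf; elim: Pf g => {f} [f f0|f f0 Pf IH] g Pg.
  by apply: eq_Pol Pg => k d; rewrite f0 add0r.
case: Pg => {g} [g g0|g g0 Pg].
  by apply: (eq_Pol (f := f)); [move=> k d; rewrite g0 addr0|apply: Pol_step].
apply: Pol_step; first exact: pboundD.
by apply: eq_Pol (IH _ Pg) => k d; ring.
Qed.

(** Discrete Leibniz rule: the difference of [f g] is [(Df) g + (Df)(Dg) + f (Dg)], which calls for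
    a nested induction. *)
Lemma PolM f g : Pol f -> Pol g -> Pol (fun k d => f k d * g k d).
Proof.
move=> Pf; elim: Pf g => {f} [f f0|f f0 Pf IHf] g Pg.
  by apply: Pol_zero => k d; rewrite f0 mul0r.
elim: Pg => {g} [g g0|g g0 Pg IHg].
  by apply: Pol_zero => k d; rewrite g0 mulr0.
apply: Pol_step; first exact: pboundM.
apply: eq_Pol (PolD (PolD (IHf g (Pol_step g0 Pg)) (IHf _ Pg)) IHg) => k d; ring.
Qed.

Lemma Pol_cst c : pbound c -> Pol (fun _ d => c d).
Proof. by move=> h; apply: Pol_step => //; apply: Pol_zero => k d; rewrite subrr. Qed.

Lemma Pol_num a : Pol (fun _ _ => a).
Proof. exact/Pol_cst/pbound_const. Qed.

Lemma Pol_big_sum f : Pol f -> Pol (fun k d => \sum_(j < k) f j d).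
Proof.
move=> Pf; apply: Pol_step.
  by apply: eq_pbound (pbound_const 0) => d; rewrite big_ord0.
by apply: eq_Pol Pf => k d; rewrite big_ord_recr /= [X in _ = X - _]addrC addrK.
Qed.

Lemma Pol_shift f : Pol f -> Pol (fun k d => f k.+1 d).
Proof.
move=> Pf; case: (Pf) => {Pf} [g g0|g g0 Pg]; first by apply: Pol_zero => k d.
by apply: eq_Pol (PolD (Pol_step g0 Pg) Pg) => k d; ring.
Qed.

Lemma Pol_index : Pol (fun k _ => k%:R).
Proof.
apply: eq_Pol (Pol_big_sum (Pol_num 1)) => k d.
by rewrite sumr_const card_ord.
Qed.

Lemma Pol_bin b : Pol (fun k _ => 'C(k, b)%:R).
Proof.
elim: b => [|b IH]; first by apply: eq_Pol (Pol_num 1) => k d; rewrite bin0.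
by apply: eq_Pol (Pol_big_sum IH) => k d; rewrite -natr_sum sum_bin.
Qed.

Definition kbound (m k d : nat) : F := (k.+1 * d.+1)%:R ^+ m.

Lemma kbound_ge0 m k d : 0 <= kbound m k d.
Proof. by rewrite exprn_ge0 ?ler0n. Qed.

Lemma kbound_mono m m' k k' d : (m <= m')%N -> (k <= k')%N -> kbound m k d <= kbound m' k' d.
Proof.
move=> mm kk; apply: (@le_trans _ _ (kbound m' k d)).
  by rewrite /kbound ler_weXn2l // ler1n muln_gt0.
by rewrite /kbound lerXn2r ?nnegrE ?ler0n // ler_nat leq_mul2r ltnS kk orbT.
Qed.

Lemma Pol_bound f : Pol f -> exists C m, 0 <= C /\ forall k d, `|f k d| <= C * kbound m k d.
Proof.
elim => {f} [f f0|f [C0 [m0 h0]] _ [C [m [Cp h]]]].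
  by exists 0, 0%N; split=> // k d; rewrite f0 normr0 mul0r.
have C0p : 0 <= C0 by have := le_trans (normr_ge0 _) (h0 0%N); rewrite expr1n mulr1.
exists (C0 + C), (m0 + m.+1)%N; split=> [|k d]; first exact: addr_ge0.
rewrite (fdiff_telescope (fun k => f k d) k); apply: le_trans (ler_normD _ _) _.
rewrite mulrDl; apply: lerD.
  apply: le_trans (h0 d) _; rewrite ler_wpM2l //.
  apply: le_trans (_ : kbound m0 0 d <= _); first by rewrite /kbound mul1n.
  by apply: kbound_mono; rewrite ?leq_addr.
apply: le_trans (ler_norm_sum _ _ _) _.
apply: (@le_trans _ _ (\sum_(j < k) C * kbound m k d)).
  by apply: ler_sum => j _; apply: le_trans (h j d) _; rewrite ler_wpM2l // kbound_mono // ltnW.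
rewrite sumr_const card_ord -mulr_natl mulrCA ler_wpM2l //.
apply: le_trans (_ : kbound m.+1 k d <= _); last by apply: kbound_mono; rewrite ?leq_addl.
rewrite /kbound exprS ler_wpM2r ?exprn_ge0 ?ler0n // ler_nat; nia.
Qed.

Lemma Pol_newton f : Pol f -> exists B (c : nat -> nat -> F),
  (forall b, pbound (c b)) /\ forall k d, f k d = \sum_(b < B) 'C(k, b)%:R * c b d.
Proof.
elim => {f} [f f0|f f0 _ [B [c [cb h]]]].
  exists 0%N, (fun _ _ => 0); split=> [b|k d]; first exact: pbound_const.
  by rewrite f0 big_ord0.
exists B.+1, (fun b d => if b is b'.+1 then c b' d else f 0%N d); split=> [[|b]|k d].
- exact: f0.
- exact: cb.
rewrite (fdiff_telescope (fun k => f k d) k) big_ord_recl bin0 mul1r; congr (_ + _).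
rewrite (eq_bigr _ (fun (j : 'I_k) _ => h j d)) exchange_big; apply: eq_bigr => b _.
by rewrite lift0 -sum_bin natr_sum mulr_suml.
Qed.

Variable A : nat.

(** The bound on [A * d.+1] puts [n] in the range where tuple counts are polynomial in [n];
    [k * k <= n] keeps the factorial ratio bounded; [0 < d] allows division by the number of
    arcs. *)
Definition Dom (k d n : nat) := [&& 0 < n, 0 < d, A * d.+1 <= n & k * k <= n]%N.

Lemma Dom_le k k' d n : (k <= k')%N -> Dom k' d n -> Dom k d n.
Proof. move=> kk /and4P[n0 d0 An kn]; apply/and4P; split=> //; nia. Qed.

Lemma Dom_gt0 k d n : Dom k d n -> 0 < n%:R :> F.
Proof. by case/and4P => n0 _ _ _; rewrite ltr0n. Qed.

Lemma Dom_ge1 k d n : Dom k d n -> 1 <= n%:R :> F.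
Proof. by case/and4P => n0 _ _ _; rewrite ler1n. Qed.

(* f has an expansion in powers of 1/n up to an error O(n^-t) on the domain, with coefficients
   in Pol and an error constant of polynomial growth in k and d. *)
Fixpoint Exp (t : nat) (f : nat -> nat -> nat -> F) : Prop :=
  if t is t'.+1 then
    exists g f1, [/\ Pol g, Exp t' f1 &
      forall k d n, Dom k d n -> f k d n = g k d + f1 k d n / n%:R]
  else exists C m, 0 <= C /\ forall k d n, Dom k d n -> `|f k d n| <= C * kbound m k d.

Lemma eq_Exp t f f' : (forall k d n, Dom k d n -> f k d n = f' k d n) -> Exp t f -> Exp t f'.
Proof.
case: t => [|t] E /=.
  by move=> [C [m [Cp h]]]; exists C, m; split=> // k d n D; rewrite -E //; apply: h.
by move=> [g [f1 [Pg Ef h]]]; exists g, f1; split=> // k d n D; rewrite -E //; apply: h.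
Qed.

Lemma Exp_small t f C m : 0 <= C ->
  (forall k d n, Dom k d n -> `|f k d n| <= C * kbound m k d / n%:R ^+ t) -> Exp t f.
Proof.
move=> Cp; elim: t f => [|t IH] f h /=.
  by exists C, m; split=> // k d n /h; rewrite divr1.
exists (fun _ _ => 0), (fun k d n => n%:R * f k d n); split; first exact: Pol_num.
  apply: IH => k d n D; have n0 := Dom_gt0 D.
  have := h _ _ _ D; rewrite exprSr invfM mulrA ler_pdivlMr //.
  by rewrite normrM normr_nat mulrC.
by move=> k d n D; have n0 := Dom_gt0 D; rewrite add0r mulrC mulKf ?lt0r_neq0.
Qed.

Lemma Exp_Pol t g : Pol g -> Exp t (fun k d _ => g k d).
Proof.
case: t => [|t] Pg /=.
  by have [C [m [Cp h]]] := Pol_bound Pg; exists C, m; split.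
exists g, (fun _ _ _ => 0); split=> //; last by move=> k d n _; rewrite mul0r addr0.
by apply: (@Exp_small t _ 0 0%N) => // k d n _; rewrite normr0 !mul0r.
Qed.

Lemma ExpD t f f' : Exp t f -> Exp t f' -> Exp t (fun k d n => f k d n + f' k d n).
Proof.
elim: t f f' => [|t IH] f f' /=.
  move=> [C [m [Cp h]]] [C' [m' [Cp' h']]]; exists (C + C'), (m + m')%N.
  split=> [|k d n D]; first exact: addr_ge0.
  apply: le_trans (ler_normD _ _) _; rewrite mulrDl; apply: lerD.
    by apply: le_trans (h _ _ _ D) _; rewrite ler_wpM2l // kbound_mono // leq_addr.
  by apply: le_trans (h' _ _ _ D) _; rewrite ler_wpM2l // kbound_mono // leq_addl.
move=> [g [f1 [Pg Ef h]]] [g' [f1' [Pg' Ef' h']]].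
exists (fun k d => g k d + g' k d), (fun k d n => f1 k d n + f1' k d n).
split; [exact: PolD|exact: IH|move=> k d n D].
by rewrite h // h' // mulrDl addrACA.
Qed.

Lemma Exp_weaken t f : Exp t.+1 f -> Exp t f.
Proof.
elim: t f => [|t IH] f [g [f1 [Pg Ef h]]]; last by exists g, f1; split=> //; apply: IH.
case: Ef => C [m [Cp hf]]; have [C' [m' [Cp' hg]]] := Pol_bound Pg.
exists (C' + C), (m' + m)%N; split=> [|k d n D]; first exact: addr_ge0.
rewrite h //; apply: le_trans (ler_normD _ _) _; rewrite mulrDl; apply: lerD.
  by apply: le_trans (hg _ _) _; rewrite ler_wpM2l // kbound_mono // leq_addr.
rewrite normrM normfV normr_nat ler_pdivrMr ?(Dom_gt0 D) //.
apply: le_trans (hf _ _ _ D) _; apply: (@le_trans _ _ (C * kbound (m' + m) k d)).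
  by rewrite ler_wpM2l // kbound_mono // leq_addl.
by rewrite ler_peMr ?(Dom_ge1 D) // mulr_ge0 // kbound_ge0.
Qed.

Lemma Exp_divn t f : Exp t f -> Exp t (fun k d n => f k d n / n%:R).
Proof.
case: t => [|t] Ef.
  case: Ef => C [m [Cp hf]]; exists C, m; split=> // k d n D.
  rewrite normrM normfV normr_nat ler_pdivrMr ?(Dom_gt0 D) //.
  apply: le_trans (hf _ _ _ D) _.
  by rewrite ler_peMr ?(Dom_ge1 D) // mulr_ge0 // kbound_ge0.
exists (fun _ _ => 0), f; split; [exact: Pol_num|exact: Exp_weaken|].
by move=> k d n _; rewrite add0r.
Qed.

Lemma ExpM t f f' : Exp t f -> Exp t f' -> Exp t (fun k d n => f k d n * f' k d n).
Proof.
elim: t f f' => [|t IH] f f' /=.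
  move=> [C [m [Cp h]]] [C' [m' [Cp' h']]]; exists (C * C'), (m + m')%N.
  split=> [|k d n D]; first exact: mulr_ge0.
  by rewrite normrM /kbound exprD mulrACA; apply: ler_pM => //; [apply: h|apply: h'].
move=> [g [f1 [Pg Ef h]]] [g' [f1' [Pg' Ef' h']]].
exists (fun k d => g k d * g' k d), (fun k d n =>
  g k d * f1' k d n + g' k d * f1 k d n + f1 k d n * f1' k d n / n%:R).
split; first exact: PolM.
  apply: ExpD; last by apply: Exp_divn; apply: IH.
  by apply: ExpD; apply: IH => //; apply: Exp_Pol.
move=> k d n D; have n0 := lt0r_neq0 (Dom_gt0 D).
by rewrite h // h' //; field.
Qed.

Lemma Exp_sum t n (f : nat -> nat -> nat -> nat -> F) :
  (forall b, (b < n)%N -> Exp t (f b)) -> Exp t (fun k d n' => \sum_(b < n) f b k d n').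
Proof.
elim: n => [|n IH] h.
  by apply: eq_Exp (Exp_Pol t (Pol_num 0)) => k d n _; rewrite big_ord0.
apply: (eq_Exp (f := fun k d n' => \sum_(b < n) f b k d n' + f n k d n')).
  by move=> k d n' _; rewrite big_ord_recr.
by apply: ExpD; [apply: IH => b bn; apply: h; apply: ltnW|apply: h].
Qed.

Lemma Exp_big_sum t f : Exp t f -> Exp t (fun k d n => \sum_(j < k) f j.+1 d n).
Proof.
elim: t f => [|t IH] f /=.
  move=> [C [m [Cp h]]]; exists C, m.+1; split=> // k d n D.
  apply: le_trans (ler_norm_sum _ _ _) _.
  apply: (@le_trans _ _ (\sum_(j < k) C * kbound m k d)).
    apply: ler_sum => j _; apply: le_trans (h _ _ _ (Dom_le (ltn_ord j) D)) _.
    by rewrite ler_wpM2l // kbound_mono.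
  rewrite sumr_const card_ord -mulr_natl mulrCA ler_wpM2l //.
  rewrite /kbound exprS ler_wpM2r ?exprn_ge0 ?ler0n // ler_nat; nia.
move=> [g [f1 [Pg Ef h]]].
exists (fun k d => \sum_(j < k) g j.+1 d), (fun k d n => \sum_(j < k) f1 j.+1 d n).
split; [exact: (Pol_big_sum (Pol_shift Pg))|exact: IH|move=> k d n D].
rewrite mulr_suml -big_split /=; apply: eq_bigr => j _; apply: h.
exact: Dom_le (ltn_ord j) D.
Qed.

End Classes.

(** * Expansion of the factorial ratio *)

Section Ratio.
Variable F : realFieldType.

Definition ffact_ratio n k : F := n%:R ^+ k * (n - k)`!%:R / n`!%:R.

Lemma ffact_ratio_ge0 n k : 0 <= ffact_ratio n k.
Proof. by rewrite !mulr_ge0 ?invr_ge0 ?exprn_ge0 ?ler0n. Qed.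

Lemma ffact_ratio0 n : ffact_ratio n 0 = 1.
Proof. by rewrite /ffact_ratio subn0 mul1r divff // pnatr_eq0 -lt0n fact_gt0. Qed.

Lemma ffact_ratioS n k : (k < n)%N ->
  ffact_ratio n k.+1 * (n - k)%:R = n%:R * ffact_ratio n k.
Proof.
move=> kn; rewrite /ffact_ratio -(@subnSK k n) // factS natrM exprS; ring.
Qed.

(** For [k <= n] the ratio is the reciprocal of the product of the [1 - j/n], so its increments are
    [j/n] times the next value. Having the ratio itself on the right, behind a factor [1/n], allows
    bootstrapping. *)
Lemma ffact_ratio_sum n k : (0 < n)%N -> (k <= n)%N ->
  ffact_ratio n k = 1 + (\sum_(j < k) j%:R * ffact_ratio n j.+1) / n%:R.
Proof.
move=> n0; have n0' : n%:R != 0 :> F by rewrite pnatr_eq0 -lt0n.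
elim: k => [|k IH] kn; first by rewrite big_ord0 mul0r addr0 ffact_ratio0.
rewrite big_ord_recr /= mulrDl addrA -IH ?(ltnW kn) //.
have := ffact_ratioS kn; rewrite natrB ?(ltnW kn) // => E.
apply: (mulfI n0'); rewrite mulrDr -E; field.
exact: n0'.
Qed.

Lemma ffact_ratio_le2 n k : (0 < n)%N -> (k * k <= n)%N -> ffact_ratio n k <= 2.
Proof.
move=> n0 kn.
(* The inductive bound is [1 / (1 - j^2/(2n))], which is at most 2 when [j^2 <= n]. *)
suff h j : (j <= k)%N -> ffact_ratio n j * ((n.*2)%:R - (j * j)%:R) <= (n.*2)%:R.
  have := h k (leqnn k); have := ffact_ratio_ge0 n k.
  have : (k * k)%:R <= n%:R :> F by rewrite ler_nat.
  have : 0 < n%:R :> F by rewrite ltr0n.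
  rewrite -addnn natrD; set a := ffact_ratio n k; set x := n%:R; set y := (k * k)%:R.
  move=> x0 yx a0 h1; have h2 : a * x <= 2 * x.
    apply: le_trans (_ : a * (x + x - y) <= _); last lra.
    by apply: ler_wpM2l => //; lra.
  by move: h2; rewrite ler_pM2r.
elim: j => [|j IH] jk; first by rewrite ffact_ratio0 mul1r mul0n subr0.
have jn : (j < n)%N by nia.
have := ffact_ratioS jn; have := IH (ltnW jk); have := ffact_ratio_ge0 n j.
have nj0 : 0 < (n - j)%:R :> F by rewrite ltr0n subn_gt0.
set a := ffact_ratio n j; set b := ffact_ratio n j.+1.
move=> a0 h E; rewrite -(ler_pM2r nj0) mulrAC E.
apply: (@le_trans _ _ (a * ((n.*2)%:R - (j * j)%:R) * (n - j)%:R)).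
  rewrite [n%:R * a]mulrC -[leLHS]mulrA -[leRHS]mulrA; apply: ler_wpM2l => //.
  rewrite natrB ?(ltnW jn) // -addnn natrD natrM.
  have : 0 <= j%:R :> F by rewrite ler0n.
  have : j.+1%:R = j%:R + 1 :> F by rewrite -natr1.
  have : 0 <= n%:R :> F by rewrite ler0n.
  rewrite natrM; set x := n%:R; set y := j%:R => x0 -> y0.
  have : 0 <= y * y * y by rewrite !mulr_ge0.
  nra.
by apply: ler_wpM2r => //; apply: ltW.
Qed.

Lemma Exp_ffact_ratio A t : exists2 f1, Exp A t f1 &
  forall k d n, Dom A k d n -> ffact_ratio n k = 1 + f1 k d n / n%:R.
Proof.
have E k d n : Dom A k d n -> ffact_ratio n k = 1 + (\sum_(j < k) j%:R * ffact_ratio n j.+1)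
  / n%:R.
  by case/and4P => n0 _ _ kn; rewrite ffact_ratio_sum //; nia.
(* Bootstrapping: an expansion of order [t] inserted in the right-hand side of [E] gives one of
   order [t.+1], starting from the bound 2. *)
have Er : Exp A t (fun k d n => ffact_ratio n k).
  elim: t => [|t IH].
    exists 2, 0%N; split=> // k d n /and4P[n0 _ _ kn].
    by rewrite ger0_norm ?ffact_ratio_ge0 // mulr1 ffact_ratio_le2.
  exists (fun _ _ => 1), (fun k d n => \sum_(j < k) (j.+1%:R - 1) * ffact_ratio n j.+1).
  split; first exact: Pol_num.
    apply: (@Exp_big_sum _ A t (fun k d n => (k%:R - 1) * ffact_ratio n k)).
    apply: ExpM => //; apply: (@Exp_Pol _ A t (fun k d => k%:R - 1)).
    by apply: PolD; [apply: Pol_index|apply: Pol_num].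
  move=> k d n /E ->; congr (_ + _ / _); apply: eq_bigr => j _.
  by rewrite -natr1 addrK.
exists (fun k d n => \sum_(j < k) (j.+1%:R - 1) * ffact_ratio n j.+1).
  apply: (@Exp_big_sum _ A t (fun k d n => (k%:R - 1) * ffact_ratio n k)).
  apply: ExpM => //; apply: (@Exp_Pol _ A t (fun k d => k%:R - 1)).
  by apply: PolD; [apply: Pol_index|apply: Pol_num].
move=> k d n /E ->; congr (_ + _ / _); apply: eq_bigr => j _.
by rewrite -natr1 addrK.
Qed.
End Ratio.

(** * The probability that random arcs form a linear forest *)

Section Density.
Variable F : realFieldType.

Definition density k d n : F := tmean (arcs d 0 n) k (fun x => (valid (inside d n) x)%:R).

Lemma density_ge0 k d n : 0 <= density k d n.
Proof.
rewrite /density /tmean mulr_ge0 ?invr_ge0 ?exprn_ge0 ?ler0n //.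
rewrite -[leLHS](mul0r ((size (arcs d 0 n))%:R ^+ k)) -tsum_const.
by apply: le_tsum => s; rewrite ler0n.
Qed.

Lemma valid_count_bounds d k n :
  0 <= valid_count F d k n <= (d.*2 * n)%:R ^+ k.
Proof.
rewrite -(size_arcs d 0 n) -[_ ^+ k]mul1r -tsum_const.
rewrite -[leLHS](mul0r ((size (arcs d 0 n))%:R ^+ k)) -tsum_const.
by apply/andP; split; apply: le_tsum => s; rewrite ?ler0n // lern1 leq_b1.
Qed.

Lemma densityE k d n : density k d n = valid_count F d k n / (d.*2 * n)%:R ^+ k.
Proof. by rewrite /density /tmean size_arcs. Qed.

Lemma density_le1 k d n : density k d n <= 1.
Proof.
rewrite densityE; have /andP[h0 h1] := valid_count_bounds d k n.
have [->|nz] := eqVneq ((d.*2 * n)%:R ^+ k : F) 0; first by rewrite invr0 mulr0.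
by rewrite ler_pdivrMr ?mul1r // lt_neqAle eq_sym nz exprn_ge0 ?ler0n.
Qed.

Lemma density0 d n : density 0 d n = 1.
Proof.
rewrite /density /tmean /= divr1 /valid /=.
by case: boolp.asboolP => // -[]; exists [::].
Qed.

(** Among the [2dn] arcs at most [(2d)^2] are out of range and at most [8d] touch a given one; both
    proportions are below [4 (d+1)/n]. *)
Lemma fdiff_density_bound d n u k : (0 < d)%N -> (0 < n)%N ->
  `|iter u (@fdiff F) (fun k => density k d n) k|
  <= 2 ^+ u.+1 * ((u + k)%:R ^+ 2 * (4 * d.+1%:R / n%:R)) ^+ uphalf u.
Proof.
move=> d0 n0; have n0' : n%:R != 0 :> F by rewrite pnatr_eq0 -lt0n.
have E : 4 * d.+1%:R / n%:R * (size (arcs d 0 n))%:R = (d.*2 * d.+1 * 4)%:R :> F.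
  by rewrite size_arcs !natrM; field.
apply: (@fdiff_tmean_bound _ _ (bad (inside d n)) touch).
- by rewrite mulr_ge0 ?invr_ge0 ?mulr_ge0 ?ler0n.
- rewrite E ler_nat; apply: leq_trans (count_bad_arcs d n) _; nia.
- move=> e; rewrite E ler_nat; apply: leq_trans (count_touch_arcs d n e) _; nia.
- rewrite -size_eq0 size_arcs; nia.
- exact: valid_insensitive.
by move=> x; rewrite normr_nat lern1 leq_b1.
Qed.

Lemma density_near1 k d n : (0 < d)%N -> (0 < n)%N ->
  `|density k d n - 1| <= 16 * kbound F 3 k d / n%:R.
Proof.
move=> d0 n0.
have := @newton_remainder F 1 (fun k => density k d n) k
  (4 * (k.+1%:R ^+ 2 * (4 * d.+1%:R / n%:R))).
rewrite big_ord1 bin0 mul1r /= density0 bin1 => h.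
have n0' : 0 < n%:R :> F by rewrite ltr0n.
apply: le_trans (h _) _ => [j jk|].
  apply: le_trans (fdiff_density_bound 1 j d0 n0) _.
  rewrite (_ : 2 ^+ 2 = 4 :> F); last by rewrite expr2; ring.
  rewrite expr1 ler_pM2l ?ltr0n // ler_wpM2r //.
    by rewrite mulr_ge0 ?invr_ge0 ?mulr_ge0 ?ler0n.
  by rewrite lerXn2r ?nnegrE ?ler0n // ler_nat add1n.
rewrite (_ : k%:R * _ = 16 * (k%:R * k.+1%:R ^+ 2 * d.+1%:R) / n%:R); last by field;
  apply: lt0r_neq0.
rewrite ler_pM2r ?invr_gt0 // ler_pM2l ?ltr0n //.
rewrite /kbound -!natrX -!natrM ler_nat.
move: k {h} d d0 => k [//|d] _; rewrite !expnS expn0 !muln1; nia.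
Qed.
End Density.

(** * Expansion of the density *)

Section Expansion.
Variable F : realFieldType.

Lemma PolX f m : Pol f -> Pol (fun k d => f k d ^+ m : F).
Proof.
move=> Pf; elim: m => [|m IH]; first exact: Pol_num.
by apply: eq_Pol (PolM Pf IH) => k d; rewrite exprS.
Qed.

Lemma Exp_divnX A t (f : nat -> nat -> nat -> F) m :
  Exp A t f -> Exp A t (fun k d n => f k d n / n%:R ^+ m).
Proof.
move=> Ef; elim: m => [|m IH]; first by apply: eq_Exp Ef => k d n _; rewrite divr1.
apply: eq_Exp (Exp_divn IH) => k d n _.
by rewrite exprSr invfM mulrA.
Qed.

Lemma Exp_bounded A t (f : nat -> nat -> nat -> F) : Exp A t f -> Exp A 0 f.
Proof. by elim: t => // t IH /Exp_weaken. Qed.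

(** From this [n] on the count for [v] arcs is polynomial in [n]; it serves as base point of
    Newton's formula. *)
Definition start v d := (d.*2.+1 * v.+1)%N.

Lemma pbound_start v b : pbound (fun d => (start v d + b)%:R : F).
Proof.
have h := pboundD (pboundM (pboundD (pboundM (pbound_const 2) (pbound_nat F)) (pbound_const 1))
  (pbound_const v.+1%:R)) (pbound_const b%:R).
apply: eq_pbound h => d; by rewrite /start natrD natrM -[d.*2.+1]addn1 natrD -mul2n natrM.
Qed.

Lemma Dom_start A v b k d n : (3 * v.+1 <= A)%N -> (b <= v.+1)%N -> Dom A k d n ->
  (start v d + b <= n)%N.
Proof.
move=> Av bv /and4P[_ _ An _]; apply: leq_trans An.
apply: leq_trans (_ : 3 * v.+1 * d.+1 <= _)%N; last by rewrite leq_mul2r Av orbT.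
by rewrite /start; nia.
Qed.

Lemma Exp_falling A t v b : (3 * v.+1 <= A)%N -> (b <= v.+1)%N ->
  Exp A t (fun _ d n => ((n - start v d) ^_ b)%:R / n%:R ^+ b : F).
Proof.
move=> Av; elim: b => [|b IH] bv.
  apply: (@eq_Exp _ _ _ (fun _ _ _ => 1)); last exact: (Exp_Pol A t (Pol_num 1)).
  by move=> k d n _; rewrite ffactn0 divr1.
have E1 : Exp A t (fun _ d n => 1 + (- 1 * (start v d + b)%:R) / n%:R : F).
  apply: ExpD; first exact: (Exp_Pol A t (Pol_num 1)).
  apply: Exp_divn; apply: (Exp_Pol A t (g := fun k d => -1 * (start v d + b)%:R)).
  by apply: Pol_cst; apply: pboundM (pbound_const _) (pbound_start v b).
apply: eq_Exp (ExpM (IH (ltnW bv)) E1) => k d n D.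
have h := Dom_start Av (ltnW bv) D.
have n0 := lt0r_neq0 (Dom_gt0 F D).
rewrite ffactnSr natrM -subnDA (natrB _ h) exprSr.
by field; rewrite n0 expf_neq0.
Qed.

Lemma fdiff_iter_offset m (f : nat -> F) a j :
  iter m (@fdiff F) (fun j => f (a + j)%N) j = iter m (@fdiff F) f (a + j)%N.
Proof. by elim: m j => //= m IH j; rewrite /fdiff !IH addnS. Qed.

Lemma valid_count_newton d v n : (start v d <= n)%N ->
  valid_count F d v n = \sum_(b < v.+1) 'C(n - start v d, b)%:R *
    iter b (@fdiff F) (valid_count F d v) (start v d).
Proof.
move=> hn; have := @newton_exact F v.+1 (fun j => valid_count F d v (start v d + j))
  (n - start v d).
rewrite subnKC // => -> => [|j].
  by apply: eq_bigr => b _; rewrite fdiff_iter_offset addn0.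
by rewrite fdiff_iter_offset valid_count_polynomial // leq_addr.
Qed.

Lemma pbound_valid_count v b :
  pbound (fun d => iter b (@fdiff F) (valid_count F d v) (start v d) / d.*2%:R ^+ v / b`!%:R).
Proof.
apply: (@pbound_le _ _ (fun d => 2 ^+ b * (2 * d%:R * (start v d + b)%:R) ^+ v)).
  move=> d; apply: (@le_trans _ _ `|iter b (@fdiff F) (valid_count F d v) (start v d)|).
    rewrite -mulrA normrM ler_piMr // -invfM ger0_norm ?invr_ge0 ?mulr_ge0 ?exprn_ge0 ?ler0n //.
    (* The denominator is a natural number. It can vanish at [d = 0], where its inverse is 0 by
       convention. *)
    rewrite -natrX -natrM; case: (posnP (d.*2 ^ v * b`!)) => [->|h]; first by rewrite invr0.
    by rewrite invf_le1 ?ltr0n // ler1n.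
  rewrite [leRHS]ger0_norm; last by rewrite mulr_ge0 ?exprn_ge0 ?mulr_ge0 ?ler0n.
  apply: fdiff_iter_bound => j jb.
  have /andP[h0 h1] := valid_count_bounds F d v j.
  rewrite ger0_norm //; apply: le_trans h1 _.
  rewrite -!natrM lerXn2r ?nnegrE ?ler0n // ler_nat -muln2 [(d * 2)%N]mulnC.
  by rewrite leq_mul2l jb orbT.
apply: pboundM (pbound_const _) _; apply: pboundX.
exact: pboundM (pboundM (pbound_const _) (pbound_nat F)) (pbound_start v b).
Qed.

(** The count has degree at most [v] in [n], so division by [n^v] leaves only nonpositive powers,
    each multiplied by a coefficient depending on [d]. *)
Lemma Exp_density_at A t v : (3 * v.+1 <= A)%N ->
  Exp A t (fun _ d n => density F v d n).
Proof.
move=> Av.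
pose c b d := iter b (@fdiff F) (valid_count F d v) (start v d) / d.*2%:R ^+ v / b`!%:R.
apply: (@eq_Exp _ _ _ (fun k d n => \sum_(b < v.+1)
   (c b d * (((n - start v d) ^_ b)%:R / n%:R ^+ b)) / n%:R ^+ (v - b))).
  move=> k d n D; have h := Dom_start Av (leq0n _) D; rewrite addn0 in h.
  have n0 := lt0r_neq0 (Dom_gt0 F D).
  have d0 : d.*2%:R != 0 :> F by case/and4P: D => _ d0 _ _; rewrite pnatr_eq0; lia.
  rewrite densityE valid_count_newton // mulr_suml; apply: eq_bigr => b _.
  rewrite /c natrM exprMn -bin_ffact natrM.
  have -> : n%:R ^+ v = n%:R ^+ b * n%:R ^+ (v - b) :> F.
    by rewrite -exprD subnKC // -ltnS.
  have f0 : b`!%:R != 0 :> F by rewrite pnatr_eq0 -lt0n fact_gt0.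
  by field; rewrite f0 !expf_neq0.
apply: (@Exp_sum _ _ _ _ (fun b k d n => (c b d * (((n - start v d) ^_ b)%:R / n%:R ^+ b))
  / n%:R ^+ (v - b))).
move=> b bv; apply: Exp_divnX; apply: ExpM; last by apply: Exp_falling => //; apply: ltnW.
by apply: (Exp_Pol A t (g := fun k d => c b d)); apply: Pol_cst; apply: pbound_valid_count.
Qed.

Lemma Exp_fdiff_density A t b v : (3 * (b + v).+1 <= A)%N ->
  Exp A t (fun _ d n => iter b (@fdiff F) (fun k => density F k d n) v).
Proof.
elim: b v => [|b IH] v h; first exact: Exp_density_at.
have E1 : Exp A t (fun _ d n => iter b (@fdiff F) (fun k => density F k d n) v.+1).
  by apply: IH; rewrite addnS -addSn.
have E2 : Exp A t (fun _ d n => iter b (@fdiff F) (fun k => density F k d n) v).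
  by apply: IH; apply: leq_trans h; rewrite leq_mul2l /=; lia.
apply: eq_Exp (ExpD E1 (ExpM (Exp_Pol A t (Pol_num (-1))) E2)) => k d n _.
by rewrite mulN1r.
Qed.

(** Newton's formula at 0 with [2t] terms. Its coefficients involve only densities of fewer than
    [2t] arcs, and its remainder carries [n^-t] because [uphalf] of [2t] is [t]. *)
Lemma Exp_density A t : (3 * t.*2.+1 <= A)%N -> Exp A t (fun k d n => density F k d n).
Proof.
move=> At.
pose S k d n := \sum_(b < t.*2) 'C(k, b)%:R * iter b (@fdiff F) (fun k => density F k d n) 0%N.
apply: (@eq_Exp _ _ _ (fun k d n => S k d n + (density F k d n - S k d n))).
  by move=> k d n _; rewrite addrC subrK.
apply: ExpD.
  apply: (@Exp_sum _ _ _ _ (fun b k d n => 'C(k, b)%:R * iter b (@fdiff F)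
    (fun k => density F k d n) 0%N)) => b bt.
  apply: ExpM; first exact: (Exp_Pol A t (Pol_bin F b)).
  by apply: Exp_fdiff_density; apply: leq_trans At; rewrite leq_mul2l /=; lia.
pose g k d : F := 'C(k, t.*2)%:R * (2 ^+ t.*2.+1 * ((t.*2%:R + k%:R) ^+ 2 * (4 * d.+1%:R)) ^+ t).
have Pg : Pol g.
  apply: PolM (Pol_bin F _) (PolM (Pol_num _) (PolX _ _)).
  apply: PolM (PolX _ (PolD (Pol_num _) (Pol_index F))) (PolM (Pol_num _)
    (Pol_cst (pbound_succ F))).
have [C [m [C0 h]]] := Pol_bound Pg.
apply: (Exp_small C0 (m := m)) => k d n D.
have n0 := Dom_gt0 F D; case/and4P: (D) => n1 d0 _ _.
apply: (@le_trans _ _ (g k d / n%:R ^+ t)); last first.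
  by rewrite ler_wpM2r ?invr_ge0 ?exprn_ge0 ?ler0n // (le_trans (ler_norm _)).
pose eps : F := 2 ^+ t.*2.+1 * ((t.*2%:R + k%:R) ^+ 2 * (4 * d.+1%:R / n%:R)) ^+ t.
have -> : g k d / n%:R ^+ t = 'C(k, t.*2)%:R * eps.
  by rewrite /g /eps !mulrA [(_ / n%:R) ^+ t]exprMn exprVn !mulrA.
apply: (@newton_remainder F t.*2 (fun k => density F k d n) k eps) => j jk.
apply: le_trans (fdiff_density_bound F _ _ d0 n1) _.
rewrite uphalf_double ler_pM2l ?exprn_gt0 ?ltr0n // lerXn2r ?nnegrE ?mulr_ge0 ?exprn_ge0
  ?addr_ge0 ?invr_ge0 ?ler0n //.
rewrite ler_wpM2r ?mulr_ge0 ?invr_ge0 ?ler0n // lerXn2r ?nnegrE ?addr_ge0 ?ler0n //.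
by rewrite natrD lerD2l ler_nat.
Qed.
End Expansion.

(** * The constant term of the expansion *)

Section Leading.
Variable F : archiRealFieldType.

Lemma eq0_of_le_inv (a C : F) N : (forall n, (N <= n)%N -> (0 < n)%N -> `|a| <= C / n%:R)
  -> a = 0.
Proof.
move=> h; apply/eqP; rewrite -normr_eq0; apply: contraT => a0.
have {}a0 : 0 < `|a| by rewrite lt_neqAle eq_sym a0 normr_ge0.
pose n := (N + Num.bound (C / `|a|)).+1.
have := h n; rewrite /n => /(_ (leqW (leq_addr _ _)) isT).
rewrite ler_pdivlMr ?ltr0n // mulrC -ler_pdivlMr // => h1.
have h2 := archi_boundP (x := C / `|a|); have : 0 <= C / `|a|.
  by apply: le_trans h1; rewrite ler0n.
move/h2 => h3; have h4 : (Num.bound (C / `|a|))%:R <= n%:R :> F by rewrite /n ler_nat; lia.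
by have := lt_le_trans h3 (le_trans h4 h1); rewrite ltxx.
Qed.

(** The leading coefficient does not depend on [n]. For fixed [k] and [d] both it and 1 are within
    O(1/n) of the density, so they agree. *)
Lemma density_leading A t : (3 * t.+1.*2.+1 <= A)%N -> exists2 f1, Exp A t f1 &
  forall k d n, Dom A k d n -> density F k d n = 1 + f1 k d n / n%:R.
Proof.
move=> At; have [g [f1 [Pg E1 h]]] := Exp_density F At.
exists f1 => // k d n D; rewrite h //; congr (_ + _).
case/and4P: (D) => _ d0 _ _.
have [C [m [C0 hf]]] := Exp_bounded E1.
apply/eqP; rewrite -subr_eq0; apply/eqP.
apply: (@eq0_of_le_inv _ (16 * kbound F 3 k d + C * kbound F m k d) (A * d.+1 + k * k)).
move=> n' hn n0; have D' : Dom A k d n' by apply/and4P; split=> //; lia.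
rewrite (_ : _ - 1 = (density F k d n' - 1) - f1 k d n' / n'%:R); last by rewrite h //; ring.
rewrite mulrDl; apply: le_trans (ler_normB _ _) _; apply: lerD; first exact: density_near1.
by rewrite normrM normfV normr_nat ler_wpM2r ?invr_ge0 ?ler0n // hf.
Qed.

Lemma main_expansion A t : (3 * t.+1.*2.+1 <= A)%N -> exists2 f1, Exp A t f1 &
  forall k d n, Dom A k d n -> ffact_ratio F n k * density F k d n = 1 + f1 k d n / n%:R.
Proof.
move=> At; have [f1 E1 h1] := density_leading At.
have [f2 E2 h2] := Exp_ffact_ratio F A t.
exists (fun k d n => (f2 k d n + f1 k d n) + (f2 k d n * f1 k d n) / n%:R).
  by apply: ExpD (ExpD E2 E1) (Exp_divn (ExpM E2 E1)).
move=> k d n D; have n0 := lt0r_neq0 (Dom_gt0 F D).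
by rewrite (h2 _ _ _ D) (h1 _ _ _ D); field.
Qed.
End Leading.

(** * Exponential sums *)

Local Notation exp := Rtrigo_def.exp.
#[local] Arguments Rtrigo_def.exp _%_ring_scope.

Definition exp_sum (x : R) K : R := (\sum_(k < K) x ^+ k / k`!%:R)%R.

Lemma exp_sum_cv x (eps : R) : 0 < eps ->
  exists N, forall m, (N <= m)%N -> `|exp_sum x m - exp x| < eps.
Proof.
move=> /RltP e0; have [N h] := proj2_sig (exist_exp x) eps e0.
exists N.+1 => -[//|m] Nm; have := h m; rewrite /Rdist sum_f_R0E => h'.
apply/RltP; rewrite -RabsE /exp_sum.
rewrite big_mkord in h'.
rewrite (eq_bigr (fun k : 'I_m.+1 => (Rmult (Rinv (INR (Factorial.fact k))) (pow x k))));
  last first.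
  by move=> k _; rewrite RmultE RinvE RpowE INRE factE mulrC.
by apply: h'; apply/ssrnat.leP.
Qed.

Lemma exp_ge_limit x c J : (forall m, (J <= m)%N -> c <= exp_sum x m) -> c <= exp x.
Proof.
move=> h; rewrite leNgt; apply/negP => lt; have e0 : 0 < c - exp x by rewrite subr_gt0.
have [N hN] := exp_sum_cv x e0; have := hN (N + J)%N (leq_addr _ _).
rewrite ltr_norml => /andP[_]; have := h (N + J)%N (leq_addl _ _); lra.
Qed.

Lemma exp_le_limit x c J : (forall m, (J <= m)%N -> exp_sum x m <= c) -> exp x <= c.
Proof.
move=> h; rewrite leNgt; apply/negP => lt; have e0 : 0 < exp x - c by rewrite subr_gt0.
have [N hN] := exp_sum_cv x e0; have := hN (N + J)%N (leq_addr _ _).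
rewrite ltr_norml => /andP[+ _]; have := h (N + J)%N (leq_addl _ _); lra.
Qed.

Lemma exp_term_ge0 (x : R) k : 0 <= x -> 0 <= x ^+ k / k`!%:R.
Proof. by move=> x0; rewrite mulr_ge0 ?exprn_ge0 ?invr_ge0 ?ler0n. Qed.

Lemma exp_sumD x J i : exp_sum x (J + i) = exp_sum x J + \sum_(k < i) x ^+ (J + k) / (J + k)`!%:R.
Proof.
elim: i => [|i IH]; first by rewrite addn0 big_ord0 addr0.
by rewrite addnS /exp_sum big_ord_recr /= -/(exp_sum x (J + i)) IH big_ord_recr /= addrA.
Qed.

Lemma exp_sum_le x J : 0 <= x -> exp_sum x J <= exp x.
Proof.
move=> x0; apply: (@exp_ge_limit _ _ J) => m Jm; rewrite -(subnKC Jm) exp_sumD lerDl.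
by apply: sumr_ge0 => k _; apply: exp_term_ge0.
Qed.

(** [J! k!] divides [(J+k)!], so the tail is dominated by its first term times the exponential
    series. *)
Lemma exp_tail_le (x : R) J i : 0 <= x ->
  \sum_(k < i) x ^+ (J + k) / (J + k)`!%:R <= exp x * (x ^+ J / J`!%:R).
Proof.
move=> x0; apply: (@le_trans _ _ (exp_sum x i * (x ^+ J / J`!%:R))); last first.
  by rewrite ler_wpM2r ?exp_sum_le // exp_term_ge0.
rewrite mulr_suml; apply: ler_sum => k _; rewrite exprD mulrACA [x ^+ J * _]mulrC -invfM.
rewrite ler_wpM2l ?mulr_ge0 ?exprn_ge0 // lef_pV2 ?posrE ?mulr_gt0 ?ltr0n ?fact_gt0 //.
rewrite -natrM ler_nat -(bin_fact (leq_addl J k)) addnK.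
by rewrite mulnC leq_pmull // bin_gt0 leq_addl.
Qed.

Lemma exp_sum_neg_error (x : R) J : 0 <= x ->
  `|exp_sum (- x) J - exp (- x)| <= exp x * (x ^+ J / J`!%:R).
Proof.
move=> x0.
have h m : (J <= m)%N -> `|exp_sum (- x) m - exp_sum (- x) J| <= exp x * (x ^+ J / J`!%:R).
  move=> Jm; rewrite -(subnKC Jm) exp_sumD addrC addKr.
  apply: le_trans (ler_norm_sum _ _ _) _; apply: le_trans (exp_tail_le J (m - J) x0).
  apply: ler_sum => k _; rewrite normrM normrX normrN (ger0_norm x0).
  by rewrite ger0_norm // invr_ge0 ler0n.
have h1 : exp (- x) <= exp_sum (- x) J + exp x * (x ^+ J / J`!%:R).
  apply: (@exp_le_limit _ _ J) => m /h; rewrite ler_norml => /andP[_]; lra.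
have h2 : exp_sum (- x) J - exp x * (x ^+ J / J`!%:R) <= exp (- x).
  apply: (@exp_ge_limit _ _ J) => m /h; rewrite ler_norml => /andP[+ _]; lra.
by rewrite ler_norml; apply/andP; split; lra.
Qed.

Lemma expR_gt0 (x : R) : 0 < exp x.
Proof. exact/RltP/exp_pos. Qed.

Lemma exp_le_mono (x y : R) : x <= y -> exp x <= exp y.
Proof.
rewrite le_eqVlt => /orP[/eqP->//|/RltP xy]; apply/ltW/RltP; exact: exp_increasing.
Qed.

Lemma exp_ge1 (x : R) : 0 <= x -> 1 <= exp x.
Proof. by move/exp_le_mono; rewrite exp_0. Qed.

Lemma exp_le1 (x : R) : x <= 0 -> exp x <= 1.
Proof. by move/exp_le_mono; rewrite exp_0. Qed.

Lemma exp_nat k : exp k%:R = exp 1 ^+ k.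
Proof. by rewrite expRX. Qed.

Lemma exp1_le3 : exp 1 <= 3.
Proof. apply/RleP; have -> : 3 = IZR 3 :> R by rewrite IZRposE INRE. exact: exp_le_3. Qed.

(** [(e x)^J / J!] is a single term of the series of [exp (e x)], and [e <= 3]. *)
Lemma exp_term_bound (x : R) J : 0 <= x -> x ^+ J / J`!%:R <= exp (3 * x - J%:R).
Proof.
move=> x0; have e0 := expR_gt0 1.
have h : (exp 1 * x) ^+ J / J`!%:R <= exp (3 * x).
  apply: (@le_trans _ _ (exp (exp 1 * x))).
    apply: le_trans (exp_sum_le J.+1 _); last by rewrite mulr_ge0 // ltW.
    rewrite /exp_sum big_ord_recr /= lerDr; apply: sumr_ge0 => k _.
    by apply: exp_term_ge0; rewrite mulr_ge0 // ltW.
  by apply: exp_le_mono; rewrite ler_wpM2r // exp1_le3.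
have E : exp (3 * x - J%:R) * exp 1 ^+ J = exp (3 * x).
  by rewrite -exp_nat expRD RplusE subrK.
by move: h; rewrite -E exprMn -mulrA mulrC ler_pM2r ?exprn_gt0.
Qed.

Lemma exp_sum_bin (y : R) b K :
  \sum_(k < K) y ^+ k / k`!%:R * 'C(k, b)%:R = y ^+ b / b`!%:R * exp_sum y (K - b).
Proof.
elim: K => [|K IH]; first by rewrite big_ord0 sub0n /exp_sum big_ord0 mulr0.
rewrite big_ord_recr /= IH; case: (ltnP K b) => Kb.
  by rewrite bin_small // mulr0 addr0 (eqP (ltnW Kb)) (eqP Kb).
rewrite subSn // /exp_sum [in RHS]big_ord_recr /= mulrDr; congr (_ + _).
rewrite mulrACA -exprD subnKC // -(bin_fact Kb) !natrM.
have bf : b`!%:R != 0 :> R by rewrite pnatr_eq0 -lt0n fact_gt0.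
have kf : (K - b)`!%:R != 0 :> R by rewrite pnatr_eq0 -lt0n fact_gt0.
have bc : 'C(K, b)%:R != 0 :> R by rewrite pnatr_eq0 -lt0n bin_gt0.
by field; rewrite bf kf bc.
Qed.

Lemma expD (x y : R) : exp (x + y) = exp x * exp y.
Proof. by rewrite expRD. Qed.

Lemma pbound_nonneg (c : nat -> R) : pbound c ->
  exists C m, 0 <= C /\ forall d, `|c d| <= C * d.+1%:R ^+ m.
Proof.
move=> [C [m h]]; exists C, m; split=> //.
by have := le_trans (normr_ge0 _) (h 0%N); rewrite expr1n mulr1.
Qed.

Definition twice (d : nat) : R := (2 * d%:R)%R.

Lemma twice_ge0 d : 0 <= twice d.
Proof. by rewrite /twice mulr_ge0 ?ler0n. Qed.

Lemma pbound_twice : pbound twice.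
Proof. exact: pboundM (pbound_const _) (pbound_nat _). Qed.

Lemma weighted_newton (y : R) B (c : nat -> R) K :
  \sum_(k < K) y ^+ k / k`!%:R * (\sum_(b < B) 'C(k, b)%:R * c b)
  = \sum_(b < B) c b * (y ^+ b / b`!%:R * exp_sum y (K - b)).
Proof.
under eq_bigr do rewrite mulr_sumr.
rewrite exchange_big; apply: eq_bigr => b _; rewrite -exp_sum_bin mulr_sumr.
by apply: eq_bigr => k _; rewrite [RHS]mulrC mulrA.
Qed.

Lemma Pol_weighted_le g : Pol g -> exists C m, 0 <= C /\ forall d K,
  \sum_(k < K) twice d ^+ k / k`!%:R * g k d <= C * d.+1%:R ^+ m * exp (twice d).
Proof.
move=> /Pol_newton[B [c [cb h]]].
have /pbound_nonneg[C [m [C0 hC]]] :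
    pbound (fun d => \sum_(b < B) `|c b d| * (twice d ^+ b / b`!%:R)).
  apply: (@pbound_sum _ _ (fun b d => `|c b d| * (twice d ^+ b / b`!%:R))) => b _.
  apply: pboundM; first by apply: pbound_le (cb b) => d; rewrite normr_id.
  exact: pboundM (pboundX _ pbound_twice) (pbound_const _).
exists C, m; split=> // d K.
under eq_bigr do rewrite h.
rewrite (@weighted_newton _ B (fun b => c b d)); apply: (@le_trans _ _ ((\sum_(b < B)
  `|c b d| * (twice d ^+ b / b`!%:R)) * exp (twice d))).
  rewrite mulr_suml; apply: ler_sum => b _.
  apply: le_trans (ler_norm _) _; rewrite normrM -[leRHS]mulrA ler_wpM2l // normrM.
  rewrite (ger0_norm (exp_term_ge0 _ (twice_ge0 d))) ler_wpM2l ?exp_term_ge0 ?twice_ge0 //.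
  rewrite ger0_norm ?exp_sum_le ?twice_ge0 //.
  by apply: sumr_ge0 => k _; apply: exp_term_ge0; apply: twice_ge0.
rewrite ler_pM2r ?expR_gt0 //; apply: le_trans (hC d); exact: ler_norm.
Qed.

Lemma Pol_alternating g : Pol g -> exists2 p, pbound p & exists C m, 0 <= C /\ forall d K,
  `|\sum_(k < K) (- twice d) ^+ k / k`!%:R * g k d - p d * exp (- twice d)|
  <= C * d.+1%:R ^+ m * exp (4 * twice d - K%:R).
Proof.
move=> /Pol_newton[B [c [cb h]]].
exists (fun d => \sum_(b < B) c b d * ((- twice d) ^+ b / b`!%:R)).
  apply: (@pbound_sum _ _ (fun b d => c b d * ((- twice d) ^+ b / b`!%:R))) => b _.
  apply: pboundM (cb b) (pboundM (pboundX _ _) (pbound_const _)).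
  by apply: pbound_le pbound_twice => d; rewrite normrN.
have /pbound_nonneg[C [m [C0 hC]]] :
    (* The factor [exp b] pays for the series being cut at [K - b] instead of [K]. *)
    pbound (fun d => \sum_(b < B) `|c b d| * (twice d ^+ b / b`!%:R * exp b%:R)).
  apply: (@pbound_sum _ _ (fun b d => `|c b d| * (twice d ^+ b / b`!%:R * exp b%:R))) => b _.
  apply: pboundM; first by apply: pbound_le (cb b) => d; rewrite normr_id.
  exact: pboundM (pboundM (pboundX _ pbound_twice) (pbound_const _)) (pbound_const _).
exists C, m; split=> // d K.
under eq_bigr do rewrite h.
rewrite (@weighted_newton _ B (fun b => c b d)) mulr_suml -sumrB.
apply: le_trans (ler_norm_sum _ _ _) _.
apply: (@le_trans _ _ ((\sum_(b < B) `|c b d| * (twice d ^+ b / b`!%:R * exp b%:R))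
  * exp (4 * twice d - K%:R))); last first.
  rewrite ler_pM2r ?expR_gt0 //; apply: le_trans (hC d); exact: ler_norm.
rewrite mulr_suml; apply: ler_sum => b _.
rewrite -!mulrA -mulrBr normrM ler_wpM2l // mulrA -mulrA.
rewrite (_ : (- twice d) ^+ b * (b`!%:R^-1 * exp_sum (- twice d) (K - b)) -
   (- twice d) ^+ b * (b`!%:R^-1 * exp (- twice d)) =
   (- twice d) ^+ b / b`!%:R * (exp_sum (- twice d) (K - b) - exp (- twice d))); last by ring.
rewrite normrM [`|_ / _|]normrM normrX normrN (ger0_norm (twice_ge0 d)) normfV normr_nat.
rewrite mulrA; apply: ler_wpM2l; first exact: exp_term_ge0 (twice_ge0 d).
apply: le_trans (exp_sum_neg_error _ (twice_ge0 d)) _.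
apply: le_trans (ler_wpM2l (ltW (expR_gt0 _)) (exp_term_bound _ (twice_ge0 d))) _.
rewrite -!expD; apply: exp_le_mono.
have : K%:R <= (K - b)%:R + b%:R :> R by rewrite -natrD ler_nat; lia.
lra.
Qed.

Lemma norm_weight d k : `|(- twice d) ^+ k / k`!%:R| = twice d ^+ k / k`!%:R.
Proof.
by rewrite normrM normrX normrN (ger0_norm (twice_ge0 d)) normfV normr_nat.
Qed.

(** * Truncation of the inclusion-exclusion sum *)

Definition cutoff n := (Nat.sqrt n).+1.

Lemma cutoff_sq k n : (k < cutoff n)%N -> (k * k <= n)%N.
Proof.
rewrite ltnS => kn; have [/ssrnat.leP h _] := Nat.sqrt_spec n (Nat.le_0_l n).
by apply: leq_trans h; apply: leq_mul.
Qed.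

Definition signed_sum (f : nat -> nat -> nat -> R) d n : R := (
  \sum_(k < cutoff n) (- twice d) ^+ k / k`!%:R * f k d n)%R.

(** Each polynomial layer keeps its signs and produces a coefficient times [exp (- twice d)]. The
    last layer is known only by a bound, so it is summed in absolute value, at the cost of
    [exp (twice d)]. The assumption on [cutoff n] absorbs the truncation of the series. *)
Lemma signed_sum_expansion A s f : Exp A s f ->
  exists2 p : nat -> nat -> R, (forall i, pbound (p i)) &
  exists C m, 0 <= C /\ forall d n, Dom A 0 d n ->
    exp (4 * twice d - (cutoff n)%:R) <= (n%:R ^+ s)^-1 ->
    `|signed_sum f d n - (\sum_(i < s) p i d / n%:R ^+ i) * exp (- twice d)|
    <= C * d.+1%:R ^+ m * exp (twice d) / n%:R ^+ s.
Proof.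
have DK k d n : (k < cutoff n)%N -> Dom A 0 d n -> Dom A k d n.
  by move=> /cutoff_sq kn /and4P[n0 d0 An _]; apply/and4P.
elim: s f => [|s IH] f.
  move=> [C [m [C0 h]]]; exists (fun _ _ => 0); first by move=> i; apply: pbound_const.
  have Pm : Pol (fun k d => ((k%:R + 1) ^+ m)%R : R).
    exact: PolX (PolD (Pol_index _) (Pol_num _)).
  have [C' [m' [C'0 h']]] := Pol_weighted_le Pm.
  exists (C * C'), (m + m')%N; split=> [|d n D _]; first exact: mulr_ge0.
  rewrite big_ord0 mul0r subr0 divr1 /signed_sum.
  apply: le_trans (ler_norm_sum _ _ _) _.
  apply: (@le_trans _ _ (C * d.+1%:R ^+ m * \sum_(k < cutoff n)
    twice d ^+ k / k`!%:R * (k%:R + 1) ^+ m)).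
    rewrite mulr_sumr; apply: ler_sum => k _; rewrite !normrM normrX normrN.
    rewrite (ger0_norm (twice_ge0 d)) normfV normr_nat mulrCA.
    apply: ler_wpM2l; first exact: exp_term_ge0 (twice_ge0 d).
    apply: le_trans (h _ _ _ (DK _ _ _ (ltn_ord k) D)) _.
    by rewrite /kbound natrM exprMn -natr1 mulrAC mulrA.
  apply: le_trans (ler_wpM2l _ (h' d (cutoff n))) _; first by rewrite mulr_ge0 ?exprn_ge0 ?ler0n.
  by rewrite le_eqVlt exprD; apply/orP; left; apply/eqP; ring.
move=> [g [f1 [Pg Ef1 hf]]].
have [p0 p0b [C0 [m0 [C0p h0]]]] := Pol_alternating Pg.
have [p pb [C [m [Cp h]]]] := IH _ Ef1.
exists (fun i => if i is i'.+1 then p i' else p0); first by case.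
exists (C0 + C), (m0 + m)%N; split=> [|d n D E]; first exact: addr_ge0.
have n0 := Dom_gt0 R D; have n1 := Dom_ge1 R D.
have Es : exp (4 * twice d - (cutoff n)%:R) <= (n%:R ^+ s)^-1.
  apply: le_trans E _; rewrite lef_pV2 ?posrE ?exprn_gt0 //.
  by rewrite ler_weXn2l.
have -> : signed_sum f d n = \sum_(k < cutoff n) (- twice d) ^+ k / k`!%:R * g k d
    + signed_sum f1 d n / n%:R.
  rewrite /signed_sum mulr_suml -big_split; apply: eq_bigr => k _ /=.
  by rewrite hf ?mulrDr ?mulrA //; apply: DK D.
have -> : \sum_(i < s.+1) (if (i : nat) is i'.+1 then p i' else p0) d / n%:R ^+ i =
    p0 d + (\sum_(i < s) p i d / n%:R ^+ i) / n%:R.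
  rewrite big_ord_recl /= divr1 mulr_suml; congr (_ + _); apply: eq_bigr => i _.
  by rewrite /bump leq0n add1n exprSr invfM mulrA.
set S0 := \sum_(k < _) _; set S1 := signed_sum _ _ _; set S2 := \sum_(i < s) _.
rewrite (_ : _ - _ = (S0 - p0 d * exp (- twice d)) + (S1 - S2 * exp (- twice d)) / n%:R);
  last by ring.
apply: le_trans (ler_normD _ _) _.
rewrite [leRHS](_ : _ = C0 * d.+1%:R ^+ (m0 + m) * exp (twice d) / n%:R ^+ s.+1
  + C * d.+1%:R ^+ (m0 + m) * exp (twice d) / n%:R ^+ s.+1); last by rewrite -!mulrDl.
apply: lerD.
  apply: le_trans (h0 d (cutoff n)) _; rewrite -!mulrA ler_wpM2l //.
  apply: ler_pM; rewrite ?exprn_ge0 ?ler0n ?(ltW (expR_gt0 _)) //.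
    by rewrite ler_weXn2l ?ler1n ?leq_addr.
  apply: le_trans E _; rewrite ler_peMl ?invr_ge0 ?exprn_ge0 ?ler0n //.
  exact/exp_ge1/twice_ge0.
rewrite normrM normfV normr_nat; apply: le_trans (ler_wpM2r _ (h d n D Es)) _.
  by rewrite invr_ge0 ler0n.
rewrite exprSr invfM !mulrA ler_wpM2r ?invr_ge0 ?ler0n // ler_wpM2r ?invr_ge0 ?exprn_ge0 ?ler0n
  //.
by rewrite ler_wpM2r ?(ltW (expR_gt0 _)) // ler_wpM2l // ler_weXn2l ?ler1n ?leq_addl.
Qed.

(** Serves past the cutoff. The ratio is at most its value [k^k/k!] at [n = k], which is a term of
    the series of [exp k]. *)
Lemma ffact_ratio_le3 n k : (k <= n)%N -> ffact_ratio R n k <= 3 ^+ k.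
Proof.
move=> kn.
have h j : (j <= k)%N -> (n ^ j * k ^_ j <= k ^ j * n ^_ j)%N.
  elim: j => [|j IH] jk; first by rewrite !expn0 !ffactn0.
  have := IH (ltnW jk); rewrite !expnSr !ffactnSr.
  move: (n ^ j)%N (k ^_ j) (k ^ j)%N (n ^_ j) => a b c e abce.
  have : (n * (k - j) <= k * (n - j))%N by nia.
  move/(leq_mul abce); rewrite !mulnA; nia.
have kf : 0 < k`!%:R :> R by rewrite ltr0n fact_gt0.
have nf : 0 < n`!%:R :> R by rewrite ltr0n fact_gt0.
apply: (@le_trans _ _ (k%:R ^+ k / k`!%:R)).
  rewrite /ffact_ratio ler_pdivlMr // mulrAC ler_pdivrMr //.
  rewrite -!natrX -!natrM ler_nat -(ffact_fact kn) -[k`!]ffactnn.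
  by have := h k (leqnn k); nia.
apply: (@le_trans _ _ (exp k%:R)).
  apply: le_trans (exp_sum_le k.+1 _); last by rewrite ler0n.
  rewrite /exp_sum big_ord_recr /= lerDr; apply: sumr_ge0 => i _.
  by apply: exp_term_ge0; rewrite ler0n.
by rewrite exp_nat lerXn2r ?nnegrE ?exp1_le3 ?ler0n // ltW // expR_gt0.
Qed.

Lemma probE n d : (0 < n)%N -> (0 < d)%N ->
  prob_mj_ge n d.+1 = \sum_(k < n.+1) (- twice d) ^+ k / k`!%:R
     * (ffact_ratio R n k * density R k d n).
Proof.
move=> n0 d0; rewrite /prob_mj_ge count_mj_geE RdivE !INRE.
rewrite (@count_avoiding (inside d n) R) ?iota_uniq ?arcs_uniq //; last first.
  by move=> v; rewrite mem_iota /inside -topredE /= addnC.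
rewrite size_iota mulr_suml; apply: eq_bigr => k _.
rewrite /ffact_ratio densityE /valid_count natrM exprMn /twice.
have -> : d.*2%:R = 2 * d%:R :> R by rewrite -mul2n natrM.
have x0 : (2 * d%:R) ^+ k != 0 :> R by rewrite expf_neq0 // mulf_neq0 ?pnatr_eq0 // -lt0n.
have y0 : n%:R ^+ k != 0 :> R by rewrite expf_neq0 // pnatr_eq0 -lt0n.
have kf : k`!%:R != 0 :> R by rewrite pnatr_eq0 -lt0n fact_gt0.
have nf : n`!%:R != 0 :> R by rewrite pnatr_eq0 -lt0n fact_gt0.
have -> : (- (2 * d%:R)) ^+ k = (-1) ^+ k * (2 * d%:R) ^+ k :> R by rewrite -exprMn mulN1r.
move: ((2 * d%:R) ^+ k) x0 (n%:R ^+ k) y0 => x x0 y y0.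
by field; rewrite x0 y0 kf nf.
Qed.

Lemma prob0 n : prob_mj_ge n 1 = 1.
Proof.
rewrite /prob_mj_ge count_mj_geE RdivE !INRE.
have -> : arcs 0 0 n = [::] by apply/nilP; rewrite /nilp size_arcs.
rewrite (eq_count (a2 := predT)) // count_predT size_permutations ?iota_uniq // size_iota.
by rewrite divff // pnatr_eq0 -lt0n fact_gt0.
Qed.

(** With [x = 6 d], that is [3 * twice d], the tail is at most [exp x * exp (3 x - cutoff n)]; hence
    the 24. *)
Lemma prob_tail n d : (0 < n)%N -> (0 < d)%N ->
  `|prob_mj_ge n d.+1 - signed_sum (fun k d n => ffact_ratio R n k * density R k d n) d n|
  <= exp (24 * d%:R - (cutoff n)%:R).
Proof.
move=> n0 d0; rewrite probE //.
have Kn : (cutoff n <= n.+1)%N by rewrite /cutoff ltnS; apply/ssrnat.leP/Nat.sqrt_le_lin.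
rewrite -(subnKC Kn) -!(big_mkord predT (fun k => (- twice d) ^+ k / k`!%:R * (ffact_ratio R n
  k * density R k d n))).
rewrite (big_cat_nat (n := cutoff n)) ?leq_addr //= big_mkord /signed_sum [X in `|X - _|]addrC
  addrK.
rewrite -{1}[cutoff n]add0n big_addn addKn big_mkord.
have y0 : 0 <= 3 * twice d by rewrite mulr_ge0 ?ler0n ?twice_ge0.
apply: le_trans (ler_norm_sum _ _ _) _.
apply: (@le_trans _ _ (\sum_(i < n.+1 - cutoff n) (3 * twice d) ^+ (cutoff n + i)
  / (cutoff n + i)`!%:R)).
  apply: ler_sum => i _; rewrite [(i + _)%N]addnC; set k := (cutoff n + i)%N.
  have kn : (k <= n)%N by have := ltn_ord i; rewrite /k; lia.
  have q0 : 0 <= ffact_ratio R n k * density R k d n.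
    by rewrite mulr_ge0 ?ffact_ratio_ge0 ?density_ge0.
  have q3 : ffact_ratio R n k * density R k d n <= 3 ^+ k.
    rewrite -[leRHS]mulr1; apply: ler_pM; rewrite ?ffact_ratio_ge0 ?density_ge0 ?density_le1 //.
    exact: ffact_ratio_le3.
  rewrite normrM (ger0_norm q0) norm_weight mulrC [(3 * twice d) ^+ k]exprMn -[leRHS]mulrA.
  by apply: ler_pM => //; apply: exp_term_ge0 (twice_ge0 d).
apply: le_trans (exp_tail_le _ _ y0) _.
apply: le_trans (ler_wpM2l (ltW (expR_gt0 _)) (exp_term_bound _ y0)) _.
rewrite -expD; apply: exp_le_mono; rewrite /twice; lra.
Qed.

Lemma prob_expansion s : exists2 p : nat -> nat -> R, (forall i, pbound (p i)) &
  exists A C m, 0 <= C /\ forall d n, Dom A 0 d n ->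
    exp (24 * d%:R - (cutoff n)%:R) <= (n%:R ^+ s.+1)^-1 ->
    `|prob_mj_ge n d.+1 - (1 + (\sum_(i < s) p i d / n%:R ^+ i) / n%:R) * exp (- twice d)|
    <= C * d.+1%:R ^+ m * exp (twice d) / n%:R ^+ s.+1.
Proof.
pose A := (3 * s.+1.*2.+1)%N.
have [f1 E1 hf] := @main_expansion R A s (leqnn _).
have [p pb [C [m [C0 h]]]] := signed_sum_expansion E1.
(* One unit of the 2 pays for the tail past the cutoff, the other for truncating the exponential
   series attached to the leading 1. *)
exists p => //; exists A, (C + 2), m; split=> [|d n D E]; first by rewrite addr_ge0.
have n0 := Dom_gt0 R D; have n1 := Dom_ge1 R D; case/and4P: (D) => n0' d0 An _.
have d0' : 0 <= d%:R :> R by rewrite ler0n.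
have E4 : exp (4 * twice d - (cutoff n)%:R) <= (n%:R ^+ s.+1)^-1.
  by apply: le_trans E; apply: exp_le_mono; rewrite /twice; lra.
have Es : exp (4 * twice d - (cutoff n)%:R) <= (n%:R ^+ s)^-1.
  apply: le_trans E4 _; rewrite lef_pV2 ?posrE ?exprn_gt0 // ler_weXn2l //.
have hT := le_trans (prob_tail n0' d0) E.
have hS : `|exp_sum (- twice d) (cutoff n) - exp (- twice d)| <= (n%:R ^+ s.+1)^-1.
  apply: le_trans (exp_sum_neg_error _ (twice_ge0 d)) _; apply: le_trans E4.
  apply: le_trans (ler_wpM2l (ltW (expR_gt0 _)) (exp_term_bound _ (twice_ge0 d))) _.
  by rewrite -expD; apply: exp_le_mono; lra.
have h1 := h d n D Es.
have EE : signed_sum (fun k d n => ffact_ratio R n k * density R k d n) d n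
    = exp_sum (- twice d) (cutoff n) + signed_sum f1 d n / n%:R.
  rewrite /signed_sum /exp_sum mulr_suml -big_split; apply: eq_bigr => k _ /=.
  rewrite hf ?mulrDr ?mulr1 ?mulrA //.
  by apply/and4P; split=> //; apply: cutoff_sq.
rewrite EE in hT.
set P := prob_mj_ge _ _ in hT *; set S := exp_sum _ _ in hT hS *.
set S1 := signed_sum _ _ _ in hT h1 *; set S2 := \sum_(i < s) _ in h1 *.
set e := exp (- twice d) in hS h1 *.
rewrite (_ : _ - _ = (P - (S + S1 / n%:R)) + (S - e) + (S1 - S2 * e) / n%:R); last by ring.
have h2 : `|(S1 - S2 * e) / n%:R| <= C * d.+1%:R ^+ m * exp (twice d) / n%:R ^+ s.+1.
  rewrite normrM normfV normr_nat exprSr invfM mulrA ler_wpM2r // invr_ge0 ler0n //.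
apply: le_trans (ler_normD _ _) _.
rewrite [leRHS](_ : _ = 2 * d.+1%:R ^+ m * exp (twice d) / n%:R ^+ s.+1
  + C * d.+1%:R ^+ m * exp (twice d) / n%:R ^+ s.+1); last by rewrite -!mulrDl addrC.
apply: lerD => //.
apply: le_trans (ler_normD _ _) _; apply: le_trans (lerD hT hS) _.
rewrite -mulr2n -[leLHS]mulr_natl ler_wpM2r ?invr_ge0 ?exprn_ge0 ?ler0n //.
have m1 : 1 <= d.+1%:R ^+ m :> R by rewrite exprn_ege1 ?ler1n.
have e1 : 1 <= exp (twice d) by exact/exp_ge1/twice_ge0.
rewrite -[leLHS]mulr1 -[leRHS]mulrA ler_wpM2l ?ler0n //.
exact: mulr_ege1.
Qed.

Lemma fold_right_seqE (f : nat -> R) a s :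
  List.fold_right (fun i acc => Rplus (f i) acc) 0 (List.seq a s) = \sum_(i < s) f (a + i)%N.
Proof.
elim: s a => [|s IH] a; first by rewrite big_ord0.
rewrite /= IH big_ord_recl addn0 RplusE; congr (_ + _); apply: eq_bigr => i _.
by rewrite lift0 addnS.
Qed.

Lemma corr_sumE s (p : nat -> nat -> R) d n : (0 < n)%N ->
  corr_sum s.+1 (fun i => extend (p i)) (INR d) n
  = (\sum_(i < s) p i.+1 d / n%:R ^+ i) / n%:R.
Proof.
move=> n0; rewrite /corr_sum subn1 /= fold_right_seqE mulr_suml; apply: eq_bigr => i _.
by rewrite extend_INR RdivE RpowE INRE add1n exprSr invfM mulrA.
Qed.

Lemma exp_le_inv_pow (d : nat) (n t K : nat) : (0 < n)%N ->
  24 * d%:R + t%:R * ln n%:R <= K%:R -> exp (24 * d%:R - K%:R) <= (n%:R ^+ t)^-1.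
Proof.
move=> n0 h; have n0' : 0 < n%:R :> R by rewrite ltr0n.
have -> : n%:R ^+ t = exp (t%:R * ln n%:R).
  rewrite mulr_natl -expRX; congr (_ ^+ _); rewrite exp_ln //; exact/RltP.
rewrite -[leRHS]mul1r ler_pdivlMr ?expR_gt0 // -expD.
apply: exp_le1; lra.
Qed.

Local Open Scope R_scope.

Lemma prob_asymptotics (s : nat) :
  exists (p : nat -> nat -> R) (m : nat),
    (forall i, exists c l, forall d, Rabs (p i d) <= c * (1 + INR d) ^ l) /\
    forall d : nat -> nat, big_O_log d ->
      exists (C : R) (N : nat), forall n : nat, (N <= n)%coq_nat ->
        Rabs (prob_mj_ge n (d n).+1
              - (1 + corr_sum s.+1 (fun i => extend (p i)) (INR (d n)) n)
                * exp (Rmult (-2) (INR (d n))))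
        <= C * ((1 + INR (d n)) ^ m * exp (Rmult 2 (INR (d n))) / INR n ^ s.+1).
Proof.
  Local Open Scope ring_scope.
have [p pb [A [C [m [C0 h]]]]] := prob_expansion s.
(* At [d = 0], outside [Dom], the probability is exactly 1, which zero coefficients match. The
   predecessor accounts for [corr_sum] starting at index 1. *)
pose p' i d : R := if d is 0%N then 0 else p i.-1 d.
exists p', m; split=> [i|d [K [N0 hK]]].
  have [c [l hc]] := pb i.-1; exists c, l => d.
  apply/RleP; rewrite RabsE RmultE RpowE RplusE INRE nat1r.
  apply: le_trans (hc d); rewrite /p'; case: d => [|d] //.
  by rewrite normr0 normr_ge0.
(* The first two terms make the tail at most [n^-(s+1)]; the third gives [A * (d n).+1 <= n], its
   [+ 1] being allowed by [ln n >= 1]. *)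
pose L := 24 * `|K| + s.+1%:R + A%:R * (`|K| + 1).
have [N hN] := log_le_sqrt L; exists C, (maxn N0 (maxn N 1)) => n /ssrnat.leP.
rewrite !geq_max => /and3P[/ssrnat.leP nN0 /ssrnat.leP nN n0].
have {hN} [/RleP hL [/RleP hln /ssrnat.leP hKn]] := hN n nN.
have {hK}/RleP hd := hK n nN0.
have -> : Rmult (IZR (-2)) (INR (d n)) = - twice (d n).
  by rewrite /twice (opp_IZR 2) RmultE RoppE IZRposE !INRE mulNr.
have -> : Rmult (IZR 2) (INR (d n)) = twice (d n).
  by rewrite /twice RmultE IZRposE !INRE.
apply/RleP; rewrite corr_sumE // RabsE !(RmultE, RminusE, RplusE, RdivE, RpowE, INRE) nat1r.
rewrite !(RmultE, INRE) in hL hd; rewrite INRE R1E in hln.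
have hD : (d n)%:R <= `|K| * ln n%:R.
  apply: le_trans hd _; rewrite ler_wpM2r ?ler_norm //; lra.
case: (posnP (d n)) => [d0|d0].
  rewrite d0 prob0 big1 ?mul0r ?addr0; last by move=> i _; rewrite mul0r.
  rewrite /twice mulr0 oppr0 exp_0 mulr1 subrr normr0.
  by rewrite !mulr_ge0 ?invr_ge0 ?exprn_ge0 ?ler0n ?(ltW (expR_gt0 _)).
have := h (d n) n.
have -> : \sum_(i < s) p' i.+1 (d n) / n%:R ^+ i = \sum_(i < s) p i (d n) / n%:R ^+ i.
  by apply: eq_bigr => i _; rewrite /p'; case: (d n) d0.
rewrite !mulrA; apply.
- apply/and4P; split=> //; apply: leq_trans hKn.
  rewrite -(ler_nat R) natrM; apply: le_trans hL.
  have h1 : A%:R * (d n).+1%:R <= A%:R * (`|K| + 1) * ln n%:R.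
    by rewrite -mulrA ler_wpM2l ?ler0n // -natr1 mulrDl mul1r lerD.
  have h2 : 0 <= (24 * `|K| + s.+1%:R) * ln n%:R.
    by rewrite mulr_ge0 ?addr_ge0 ?mulr_ge0 ?ler0n //; lra.
  by rewrite /L mulrDl; lra.
- apply: exp_le_inv_pow => //; apply: le_trans hL.
  have h2 : 0 <= A%:R * (`|K| + 1) * ln n%:R.
    by rewrite !mulr_ge0 ?addr_ge0 ?ler0n //; lra.
  rewrite /L !mulrDl -mulrA; lra.
Qed.

End Jumps.

(** * Passage to functions of a real variable *)

Open Scope R_scope.

Theorem theorem2 (t : nat) (ht : (1 <= t)%nat) :
  exists (p : nat -> R -> R) (q : R -> R),
    (forall i : nat, (1 <= i <= t - 1)%nat -> poly_bounded (p i)) /\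
    poly_bounded q /\
    forall d : nat -> nat, big_O_log d ->
      exists (C : R) (N : nat), forall n : nat, (N <= n)%nat ->
        Rabs (prob_mj_ge n (d n + 1)
              - (1 + corr_sum t p (INR (d n)) n) * exp (- 2 * INR (d n)))
        <= C * (Rabs (q (INR (d n))) * exp (2 * INR (d n)) / INR n ^ t).
Proof.
destruct t as [|s]; [exfalso; lia|].
destruct (Jumps.prob_asymptotics s) as (p & m & hp & h).
exists (fun i => extend (p i)), (fun x => (1 + Rabs x) ^ m).
split; [|split].
- intros i _; destruct (hp i) as (c & l & hc); exact (extend_poly_bounded _ _ _ hc).
- exists 1, m; intros x; assert (hx := Rabs_pos x).
  rewrite Rabs_pos_eq by (apply pow_le; lra); lra.
- intros d hd; destruct (h d hd) as (C & N & hN); exists C, N; intros n hn.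
  assert (hdn := pos_INR (d n)).
  rewrite (Rabs_pos_eq (INR (d n))) by assumption.
  rewrite (Rabs_pos_eq ((1 + INR (d n)) ^ m)) by (apply pow_le; lra).
  rewrite Nat.add_1_r; exact (hN n hn).
Qed.
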